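(* Let $E_\alpha(z)=\sum_{k=0}^\infty \frac{z^k}{\Gamma(\alpha k+1)}$ be the Mittag-Leffler function. For $0<\alpha<1$, the function $x\mapsto E_\alpha(x^\alpha)$ is log-concave on $(0,\infty)$. For $1<\alpha<2$, the function $x\mapsto E_\alpha(x^\alpha)$ is log-convex on $(0,\infty)$. *)

(* Defs.v *)
From Stdlib Require Import Reals.
From Coquelicot Require Import Coquelicot.
Open Scope R_scope.

Definition Gamma (s : R) : R :=
  RInt_gen (fun t => Rpower t (s - 1) * exp (- t))
           (at_right 0) (Rbar_locally p_infty).

Definition mittag_leffler (alpha z : R) : R :=
  Series (fun k : nat => z ^ k / Gamma (alpha * INR k + 1)).

Definition concave_pos (g : R -> R) : Prop :=
  forall x y t, 0 < x -> 0 < y -> 0 <= t <= 1 ->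
    t * g x + (1 - t) * g y <= g (t * x + (1 - t) * y).

Definition convex_pos (g : R -> R) : Prop :=
  forall x y t, 0 < x -> 0 < y -> 0 <= t <= 1 ->
    g (t * x + (1 - t) * y) <= t * g x + (1 - t) * g y.

Definition log_concave_pos (f : R -> R) : Prop :=
  (forall x, 0 < x -> 0 < f x) /\ concave_pos (fun x => ln (f x)).

Definition log_convex_pos (f : R -> R) : Prop :=
  (forall x, 0 < x -> 0 < f x) /\ convex_pos (fun x => ln (f x)).

(* Main.v *)
(*
Write f(x) = E_a(x^a). For 0 < a < 1 it suffices that f <= f' and f'' <= f',
since then f f'' <= f f' <= f'^2; for 1 < a < 2 the inequalities f' <= f and
f' <= f'' give f'^2 <= f f''.

Both are read off a discretisation in the spirit of Post and Widder. With
y = 1 - z and h = x / n, the n-th coefficient of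
A = sum_k h^(a k) y^(-a k - 1) = y^(a - 1) / (y^a - h^a) tends to f(x) by Gauss's
limit formula for Gamma and dominated convergence, and those of y A / h and
y^2 A / h^2 tend to f'(x) and f''(x). So one needs the signs of the coefficients
of (y - h) A and of y (y - h) A. For 0 < b < 1 the series
q_b = (y^b - h^b) / (y - h) has positive, decreasing and log-convex
coefficients, so 1 / q_b has nonpositive coefficients after the first one
(Kaluza). If a < 1, then
  (y - h) A = 1 / (1 - h^a q_(1-a)),   y (y - h) A = (y - h) + h^a / q_a;
if a > 1 and b = a - 1, then
  1 - (y - h) A = h / (y + h^b / q_b),
  y (y - h) A = (y - h) + h^a / (y q_b + h^b).
In each case the denominators on the right have coefficients of known sign.
*)
Require Import Defs.
From Stdlib Require Import Reals Lra Lia Arith FunctionalExtensionality.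
From Coquelicot Require Import Coquelicot.
Open Scope R_scope.

(** * Formal power series *)

(** Passing to coefficients in z turns differentiation into algebra: multiplication by y is the
    backward difference, so y / h is a difference quotient of step h, and the signs become
    statements about reciprocals of formal power series. The identities involved are then ring
    identities, with every quotient u / d represented by an equation d e = u. The analytic input to
    these signs is q_b. Its denominator y - h = (1 - h) - z has the root z = 1 - h, and the
    positivity of q_b expresses that y^b - h^b vanishes there too, that is, it rests on the value of
    the binomial series at this point. *)

Definition shift (a : nat -> R) : nat -> R := fun n => a (S n).

(** The Cauchy product, computed by peeling the constant term of the left factor: the ring laws
    follow by induction on the index with that factor generalised. *)
Fixpoint conv (a b : nat -> R) (n : nat) : R :=
  match n with
  | O => a O * b O
  | S m => a O * b (S m) + conv (shift a) b m
  end.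

Definition cst (r : R) : nat -> R :=
  fun n => match n with O => r | S _ => 0 end.
Definition fadd (a b : nat -> R) : nat -> R := fun n => a n + b n.
Definition fopp (a : nat -> R) : nat -> R := fun n => - a n.
Definition fsub (a b : nat -> R) : nat -> R := fadd a (fopp b).

Lemma conv_S a b n : conv a b (S n) = a O * b (S n) + conv (shift a) b n.
Proof. reflexivity. Qed.

Lemma conv_ext_le a a' b b' n :
  (forall k, (k <= n)%nat -> a k = a' k) ->
  (forall k, (k <= n)%nat -> b k = b' k) -> conv a b n = conv a' b' n.
Proof.
  revert a a'; induction n as [|n IH]; intros a a' Ha Hb.
  - simpl. rewrite Ha, Hb by lia. reflexivity.
  - rewrite !conv_S, Ha, Hb by lia. f_equal. apply IH; intros k Hk.
    + apply Ha; lia.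
    + apply Hb; lia.
Qed.

Lemma conv_plus_l a a' b n :
  conv (fun k => a k + a' k) b n = conv a b n + conv a' b n.
Proof.
  revert a a'; induction n as [|n IH]; intros a a'; [simpl; ring|].
  rewrite !conv_S. unfold shift at 1. rewrite IH. unfold shift. ring.
Qed.

Lemma conv_scal_l r a b n : conv (fun k => r * a k) b n = r * conv a b n.
Proof.
  revert a; induction n as [|n IH]; intros a; [simpl; ring|].
  rewrite !conv_S. unfold shift at 1. rewrite IH. unfold shift. ring.
Qed.

Lemma conv_scal_r r a b n : conv a (fun k => r * b k) n = r * conv a b n.
Proof.
  revert a; induction n as [|n IH]; intros a; [simpl; ring|].
  rewrite !conv_S, IH. ring.
Qed.

Lemma conv_S_r a b n : conv a b (S n) = conv a (shift b) n + a (S n) * b O.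
Proof.
  revert a; induction n as [|n IH]; intros a; [simpl; unfold shift; ring|].
  rewrite conv_S, IH, (conv_S a). unfold shift. ring.
Qed.

Lemma conv_comm a b : conv a b = conv b a.
Proof.
  apply functional_extensionality; intros n.
  revert a; induction n as [|n IH]; intros a; [simpl; ring|].
  rewrite conv_S, IH, conv_S_r. ring.
Qed.

Lemma conv_assoc a b c : conv a (conv b c) = conv (conv a b) c.
Proof.
  apply functional_extensionality; intros n.
  revert a; induction n as [|n IH]; intros a; [simpl; ring|].
  rewrite (conv_S a), IH, (conv_S (conv a b)).
  replace (shift (conv a b))
    with (fun k => a O * shift b k + conv (shift a) b k)
    by (apply functional_extensionality; intros k; reflexivity).
  rewrite conv_plus_l, conv_scal_l, conv_S. simpl. ring.
Qed.

Lemma conv_cst r b : conv (cst r) b = fun n => r * b n.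
Proof.
  apply functional_extensionality; intros [|n]; [reflexivity|].
  rewrite conv_S. replace (conv (shift (cst r)) b n) with 0; [simpl; ring|].
  rewrite (conv_ext_le (shift (cst r)) (fun k => 0 * shift (cst r) k) b b).
  - rewrite conv_scal_l; ring.
  - intros k _. unfold shift. simpl. ring.
  - reflexivity.
Qed.

(** Registered so that [ring] settles identities between series. Inverses are outside the structure;
    a reciprocal appears as an equation [conv d e = cst r]. *)
Lemma fps_ring_theory :
  ring_theory (cst 0) (cst 1) fadd conv fsub fopp (@eq (nat -> R)).
Proof.
  constructor; intros; try (apply functional_extensionality; intros n);
    unfold fsub, fadd, fopp; try (destruct n; simpl; ring); try reflexivity.
  - rewrite conv_cst. ring.
  - apply (f_equal (fun s => s n)), conv_comm.
  - apply (f_equal (fun s => s n)), conv_assoc.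
  - apply conv_plus_l.
Qed.
Add Ring fps_ring : fps_ring_theory.

(* Coefficients of [(1 - z)^(-s)]. *)
Fixpoint rise (s : R) (n : nat) : R :=
  match n with
  | O => 1
  | S m => rise s m * (s + INR m) / INR (S m)
  end.

Lemma rise_S s n : INR (S n) * rise s (S n) = (s + INR n) * rise s n.
Proof. cbn [rise]. field. apply not_0_INR; lia. Qed.

(** Leibniz rule for z d/dz, which multiplies the n-th coefficient by n. *)
Lemma conv_theta a b n :
  INR n * conv a b n =
  conv (fun k => INR k * a k) b n + conv a (fun k => INR k * b k) n.
Proof.
  revert a; induction n as [|n IH]; intros a; [simpl; ring|].
  rewrite !conv_S, Rmult_plus_distr_l.
  replace (shift (fun k => INR k * a k))
    with (fun k => INR k * shift a k + shift a k)
    by (apply functional_extensionality; intros k; unfold shift;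
        rewrite S_INR; ring).
  rewrite conv_plus_l.
  replace (INR (S n) * conv (shift a) b n)
    with (INR n * conv (shift a) b n + conv (shift a) b n)
    by (rewrite S_INR; ring).
  rewrite IH. simpl (INR 0). ring.
Qed.

(* Vandermonde's identity, from the equation [(1 - z) F' = s F] satisfied by
   [F = (1 - z)^(-s)]. *)
Lemma conv_rise s t : conv (rise s) (rise t) = rise (s + t).
Proof.
  apply functional_extensionality; intros n.
  induction n as [|n IH]; [simpl; ring|].
  assert (Hn : INR (S n) <> 0) by (apply not_0_INR; lia).
  apply Rmult_eq_reg_l with (INR (S n)); [|exact Hn].
  rewrite rise_S, <- IH, conv_theta, conv_S, conv_S_r. simpl (INR 0).
  replace (shift (fun k => INR k * rise s k))
    with (fun k => s * rise s k + INR k * rise s k)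
    by (apply functional_extensionality; intros k; unfold shift;
        rewrite rise_S; ring).
  replace (shift (fun k => INR k * rise t k))
    with (fun k => t * rise t k + INR k * rise t k)
    by (apply functional_extensionality; intros k; unfold shift;
        rewrite rise_S; ring).
  rewrite (conv_comm (rise s) (fun k => t * rise t k + INR k * rise t k)).
  rewrite !conv_plus_l, !conv_scal_l.
  rewrite (Rmult_plus_distr_r (s + t)), conv_theta.
  rewrite (conv_comm (rise t) (rise s)).
  rewrite (conv_comm (fun k => INR k * rise t k) (rise s)). ring.
Qed.

Lemma rise_0 : rise 0 = cst 1.
Proof.
  apply functional_extensionality; intros n.
  induction n as [|[|n] IH]; try reflexivity.
  - simpl. field.
  - cbn [rise] in *. rewrite IH. simpl. unfold Rdiv. ring.
Qed.

Lemma rise_m1 n : (2 <= n)%nat -> rise (-1) n = 0.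
Proof.
  intros H; destruct n as [|[|n]]; try lia. clear H.
  induction n as [|n IH]; [simpl; field|].
  cbn [rise] in *. rewrite IH. unfold Rdiv. ring.
Qed.

(** Coefficient form of (s + z d/dz) (1 - z)^(-s) = s (1 - z)^(-s-1). It measures the effect of one
    multiplication by y. *)
Lemma rise_succ s n : s * rise (s + 1) n = (s + INR n) * rise s n.
Proof.
  induction n as [|n IH]; [simpl; ring|].
  assert (Hn : INR (S n) <> 0) by (apply not_0_INR; lia).
  apply Rmult_eq_reg_l with (INR (S n)); [|exact Hn].
  replace (INR (S n) * (s * rise (s + 1) (S n)))
    with (s * (INR (S n) * rise (s + 1) (S n))) by ring.
  rewrite rise_S.
  replace (INR (S n) * ((s + INR (S n)) * rise s (S n)))
    with ((s + INR (S n)) * (INR (S n) * rise s (S n))) by ring.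
  rewrite rise_S, <- IH, S_INR. ring.
Qed.

Lemma rise_pos s n : 0 < s -> 0 < rise s n.
Proof.
  intros Hs; induction n as [|n IH]; [simpl; lra|].
  cbn [rise]. apply Rdiv_lt_0_compat; [|apply lt_0_INR; lia].
  apply Rmult_lt_0_compat; [exact IH|]. pose proof (pos_INR n); lra.
Qed.

(** Each factor (s + 1 + m) / (m + 1) is at most 1 + s. For fixed n the bound is polynomial in s,
    hence summable against a geometric sequence. *)
Lemma rise_le s n : 0 <= s -> rise (s + 1) n <= (1 + s) ^ n.
Proof.
  intros Hs; induction n as [|n IH]; [simpl; lra|].
  cbn [rise pow]. assert (H := lt_0_INR (S n) ltac:(lia)).
  pose proof (pos_INR n).
  assert (Hp : 0 < rise (s + 1) n) by (apply rise_pos; lra).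
  unfold Rdiv. rewrite Rmult_assoc, Rmult_comm.
  apply Rmult_le_compat; [|lra| |exact IH].
  - apply Rmult_le_pos; [lra|]. left; apply Rinv_0_lt_compat; lra.
  - apply Rmult_le_reg_r with (INR (S n)); [lra|].
    rewrite Rmult_assoc, Rinv_l, S_INR by lra. nra.
Qed.

(** * Signs of the coefficients of a reciprocal *)

Lemma conv_le_r a b b' n :
  (forall k, (k <= n)%nat -> a k * b (n - k)%nat <= a k * b' (n - k)%nat) ->
  conv a b n <= conv a b' n.
Proof.
  revert a; induction n as [|n IH]; intros a H; [apply (H O); lia|].
  rewrite !conv_S. apply Rplus_le_compat; [apply (H O); lia|].
  apply IH. intros k Hk. apply (H (S k)); lia.
Qed.

(** The coefficient equation reads d_0 e_(n+1) = - sum_k d_(k+1) e_(n-k), and by induction every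
    summand - d_(k+1) e_(n-k) is nonnegative. *)
Lemma recip_nonneg d e r :
  0 < d O -> (forall n, d (S n) <= 0) -> 0 <= r -> conv d e = cst r ->
  forall n, 0 <= e n.
Proof.
  intros Hd0 Hd Hr He n.
  induction n as [n IH] using lt_wf_ind.
  assert (Hn := f_equal (fun s => s n) He); cbv beta in Hn.
  destruct n as [|n].
  - simpl in Hn. nra.
  - rewrite conv_S in Hn. simpl in Hn.
    assert (H : conv (shift d) e n <= conv (shift d) (fun k => 0 * e k) n).
    { apply conv_le_r. intros k Hk.
      specialize (Hd k). specialize (IH (n - k)%nat ltac:(lia)).
      unfold shift. nra. }
    rewrite conv_scal_r in H. nra.
Qed.


(** Log-convexity makes the ratios a_(i+1) / a_i increase; this compares the ratios at i and i + j
    without division. *)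
Lemma log_convex_cross a :
  (forall n, 0 < a n) ->
  (forall n, a (S n) * a (S n) <= a n * a (S (S n))) ->
  forall i j, a (S i) * a (i + j)%nat <= a i * a (S (i + j)).
Proof.
  intros Hp Hc i j. induction j as [|j IH].
  - rewrite Nat.add_0_r. lra.
  - rewrite Nat.add_succ_r.
    apply Rmult_le_reg_r with (a (i + j)%nat); [apply Hp|].
    assert (H1 := Hc (i + j)%nat). assert (H2 := Hp (S (i + j))).
    assert (H3 := Hp i).
    apply Rle_trans with (a i * a (S (i + j)) * a (S (i + j))); nra.
Qed.

(* Kaluza's theorem. *)
Lemma recip_log_convex a r :
  (forall n, 0 < a n) ->
  (forall n, a (S n) * a (S n) <= a n * a (S (S n))) ->
  forall c, 0 <= c -> conv r a = cst c -> forall n, r (S n) <= 0.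
Proof.
  intros Hp Hc c Hc0 He n.
  assert (H0 : r O * a O = c) by exact (f_equal (fun s => s O) He).
  assert (Hr0 : 0 <= r O) by (specialize (Hp O); nra).
  induction n as [n IH] using lt_wf_ind.
  assert (Hn := f_equal (fun s => s (S n)) He); cbv beta in Hn.
  rewrite conv_S in Hn. simpl (cst c (S n)) in Hn.
  destruct n as [|n].
  - simpl in Hn. unfold shift in Hn. assert (P0 := Hp O). assert (P1 := Hp 1%nat). nra.
  - rewrite conv_S_r in Hn.
    assert (Hm := f_equal (fun s => s (S n)) He); cbv beta in Hm.
    rewrite conv_S in Hm. simpl (cst c (S n)) in Hm.
    (* The equations for the indices n + 1 and n + 2 are multiplied by a_(n+2) and a_(n+1) and
       subtracted. This eliminates r_0 and leaves r_(k+1) times a_(n+2) a_(n-k) - a_(n+1) a_(n-k+1),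
       which is nonnegative. *)
    assert (H : conv (shift r) (fun k => a (S (S n)) * a k) n <=
                conv (shift r) (fun k => a (S n) * shift a k) n).
    { apply conv_le_r. intros k Hk. specialize (IH k ltac:(lia)).
      assert (H := log_convex_cross a Hp Hc (n - k) (S k)).
      replace (n - k + S k)%nat with (S n) in H by lia.
      unfold shift. nra. }
    rewrite !conv_scal_r in H. unfold shift at 3 in Hn.
    assert (P0 := Hp O). assert (P1 := Hp (S n)). assert (P2 := Hp (S (S n))).
    apply Rmult_le_reg_r with (a O * a (S n)); [nra|]. nra.
Qed.

(** * Divided differences of powers *)

Lemma conv_rise_m1 a :
  conv (rise (-1)) a =
  fun n => match n with O => a O | S m => a (S m) - a m end.
Proof.
  replace (rise (-1)) with (fun n => cst 1 n + conv (cst (-1))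
     (fun n => match n with O => 0 | S m => cst 1 m end) n).
  - apply functional_extensionality; intros n.
    rewrite conv_plus_l, <- conv_assoc, !conv_cst.
    destruct n as [|n]; [simpl; ring|]. rewrite conv_S.
    replace (shift _) with (cst 1) by reflexivity. rewrite conv_cst. ring.
  - apply functional_extensionality; intros n. rewrite conv_cst.
    destruct n as [|[|n]]; [simpl; ring|simpl; field|].
    rewrite rise_m1 by lia. simpl. ring.
Qed.

(** [- rise (- b) (S n)] are the coefficients of 1 - (1 - z)^b beyond the constant term: the first
    is b, and the successive ratios (n + 1 - b) / (n + 2) lie in (0, 1). *)
Lemma rise_neg_bound b n : 0 < b < 1 -> 0 < - rise (- b) (S n) <= 1.
Proof.
  intros Hb; induction n as [|n IH]; [simpl; lra|].
  assert (Hr := rise_S (- b) (S n)). rewrite !S_INR in Hr.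
  pose proof (pos_INR n).
  set (u := rise (- b) (S n)) in *. set (v := rise (- b) (S (S n))) in *.
  split; nra.
Qed.

Lemma rise_neg_decr b n :
  0 < b < 1 -> - rise (- b) (S (S n)) <= - rise (- b) (S n).
Proof.
  intros Hb. assert (Hr := rise_S (- b) (S n)). rewrite !S_INR in Hr.
  pose proof (pos_INR n). pose proof (rise_neg_bound b n Hb).
  pose proof (rise_neg_bound b (S n) Hb). nra.
Qed.

(** Log-convexity put as nonnegativity of a quadratic in x: this is linear in the coefficients,
    hence survives the weighted sums that define q_b. The successive ratios satisfy p <= q, and the
    quadratic is u ((x - p)^2 + p (q - p)). *)
Lemma rise_neg_log_convex b n x :
  0 < b < 1 ->
  0 <= - rise (- b) (S n) * x ^ 2 - 2 * - rise (- b) (S (S n)) * x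
       + - rise (- b) (S (S (S n))).
Proof.
  intros Hb. assert (H1 := rise_S (- b) (S n)).
  assert (H2 := rise_S (- b) (S (S n))). rewrite !S_INR in H1. rewrite !S_INR in H2.
  pose proof (pos_INR n). pose proof (rise_neg_bound b n Hb).
  set (u := - rise (- b) (S n)) in *. set (m := INR n) in *.
  replace (- rise (- b) (S (S n))) with (u * ((m + 1 - b) / (m + 2))).
  2:{ unfold u. apply Rmult_eq_reg_l with (m + 2); [|lra].
      transitivity (- ((- b + (m + 1)) * rise (- b) (S n))); [field; lra|].
      rewrite <- H1. ring. }
  replace (- rise (- b) (S (S (S n))))
    with (u * ((m + 1 - b) / (m + 2)) * ((m + 2 - b) / (m + 3))).
  2:{ unfold u. apply Rmult_eq_reg_l with ((m + 2) * (m + 3)); [|nra].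
      transitivity (- ((- b + (m + 1)) * rise (- b) (S n)) * (- b + (m + 1 + 1)));
        [field; lra|].
      rewrite <- H1.
      transitivity (- (m + 1 + 1) *
          ((- b + (m + 1 + 1)) * rise (- b) (S (S n)))); [ring|].
      rewrite <- H2. ring. }
  set (p := (m + 1 - b) / (m + 2)).
  assert (Hp : 0 < p) by (apply Rdiv_lt_0_compat; lra).
  assert (Hq : p <= (m + 2 - b) / (m + 3)).
  { apply Rmult_le_reg_r with ((m + 2) * (m + 3)); [nra|]. unfold p.
    replace ((m + 1 - b) / (m + 2) * ((m + 2) * (m + 3)))
      with ((m + 1 - b) * (m + 3)) by (field; lra).
    replace ((m + 2 - b) / (m + 3) * ((m + 2) * (m + 3)))
      with ((m + 2 - b) * (m + 2)) by (field; lra). nra. }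
  set (q := (m + 2 - b) / (m + 3)) in *.
  replace (u * x ^ 2 - 2 * (u * p) * x + u * p * q)
    with (u * ((x - p) ^ 2 + p * (q - p))) by ring.
  apply Rmult_le_pos; [lra|]. pose proof (pow2_ge_0 (x - p)). nra.
Qed.

(** Both sides solve (1 - x) F' = - b F with F(0) = 1: the product of the power series with (1 -
    x)^(-b) has derivative zero on [0, r]. *)
Lemma binomial_series b r :
  0 < b < 1 -> 0 <= r < 1 ->
  is_series (fun n => rise (- b) n * r ^ n) (Rpower (1 - r) b).
Proof.
  intros Hb Hr. set (a := rise (- b)).
  assert (Ha : forall n, Rabs (a n) <= 1).
  { intros [|n]; [unfold a; simpl; rewrite Rabs_R1; lra|].
    pose proof (rise_neg_bound b n Hb). unfold a.
    rewrite <- Rabs_Ropp, Rabs_pos_eq; lra. }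
  assert (Hcv : forall x, Rabs x < 1 -> Rbar_lt (Rabs x) (CV_radius a)).
  { intros x Hx. apply Rbar_lt_le_trans with 1; [exact Hx|].
    apply (proj1 (CV_radius_bounded a)). exists 1. intros n.
    rewrite pow1, Rmult_1_r. apply Ha. }
  assert (Hex : forall x, Rabs x < 1 -> ex_pseries a x)
    by (intros x Hx; apply CV_radius_inside, Hcv, Hx).
  assert (Hex' : forall x, Rabs x < 1 -> ex_pseries (PS_derive a) x)
    by (intros x Hx; apply CV_radius_inside; rewrite CV_radius_derive; apply Hcv, Hx).
  assert (Hode : forall x, Rabs x < 1 ->
    (1 - x) * PSeries (PS_derive a) x = - b * PSeries a x).
  { intros x Hx.
    replace ((1 - x) * PSeries (PS_derive a) x)
      with (PSeries (PS_derive a) x - x * PSeries (PS_derive a) x) by ring.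
    rewrite <- PSeries_incr_1, <- PSeries_minus, <- PSeries_scal.
    - apply PSeries_ext. intros n.
      change (INR (S n) * a (S n) + - PS_incr_1 (PS_derive a) n = - b * a n).
      unfold a at 1. rewrite rise_S. fold a. destruct n as [|n].
      + change (PS_incr_1 (PS_derive a) 0) with 0. simpl. ring.
      + change (PS_incr_1 (PS_derive a) (S n)) with (INR (S n) * a (S n)). ring.
    - apply Hex', Hx.
    - apply ex_pseries_incr_1, Hex', Hx. }
  assert (Heq : PSeries a r = Rpower (1 - r) b).
  { destruct (Req_dec r 0) as [->|Hr0].
    { rewrite PSeries_0. unfold a; simpl. rewrite Rminus_0_r. unfold Rpower.
      rewrite ln_1, Rmult_0_r, exp_0. reflexivity. }
    assert (Hc : PSeries a 0 * Rpower (1 - 0) (- b) =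
                 PSeries a r * Rpower (1 - r) (- b)).
    { apply (eq_is_derive (fun x => PSeries a x * Rpower (1 - x) (- b))); [|lra].
      intros x Hx. assert (Hx1 : Rabs x < 1) by (rewrite Rabs_pos_eq; lra).
      evar_last.
      - apply @is_derive_mult; [apply is_derive_PSeries, Hcv, Hx1| |apply Rmult_comm].
        unfold Rpower. auto_derive; [lra|reflexivity].
      - unfold plus, mult, zero; cbn -[PSeries]. unfold Rpower.
        change (1 + - x) with (1 - x).
        transitivity (/ (1 - x) * exp (- b * ln (1 - x)) *
          ((1 - x) * PSeries (PS_derive a) x + b * PSeries a x));
          [field; lra|].
        rewrite Hode by exact Hx1. ring. }
    rewrite PSeries_0, Rpower_Ropp in Hc. rewrite Rpower_Ropp in Hc.
    unfold a at 1 in Hc. simpl in Hc. rewrite Rminus_0_r in Hc.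
    unfold Rpower at 1 in Hc. rewrite ln_1, Rmult_0_r, exp_0 in Hc.
    assert (Hp : 0 < Rpower (1 - r) b) by (unfold Rpower; apply exp_pos).
    apply Rmult_eq_reg_r with (/ Rpower (1 - r) b);
      [|apply Rinv_neq_0_compat; lra].
    rewrite <- Hc. field. lra. }
  rewrite <- Heq. unfold PSeries. apply Series_correct.
  apply ex_series_ext with (fun n => scal (pow_n r n) (a n)).
  - intros n. rewrite pow_n_pow. unfold scal; simpl; unfold mult; simpl. ring.
  - apply Hex. rewrite Rabs_pos_eq; lra.
Qed.

(* [(y^b - h^b) / (y - h)] with [y = 1 - z]. *)
Lemma divided_difference b h :
  0 < b < 1 -> 0 < h < 1 ->
  exists q : nat -> R,
    conv (fsub (rise (-1)) (cst h)) q =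
      fsub (rise (- b)) (cst (Rpower h b)) /\
    (forall n, 0 < q n) /\
    (forall n, q (S n) <= q n) /\
    (forall n, q (S n) * q (S n) <= q n * q (S (S n))).
Proof.
  intros Hb Hh. set (r := 1 - h). assert (Hr : 0 < r < 1) by (unfold r; lra).
  (* With c_m = [rise (- b) m] and y - h = r - z, the numerator is the sum of c_m (z^m - r^m), since
     the c_m r^m sum to h^b. Dividing termwise by r - z gives q_n = - sum_j c_(n+1+j) r^j. *)
  set (t := fun n j => - rise (- b) (S (n + j)) * r ^ j).
  assert (Ht : forall n j, 0 < t n j).
  { intros n j. apply Rmult_lt_0_compat; [apply rise_neg_bound, Hb|].
    apply pow_lt; lra. }
  assert (Hex : forall n, ex_series (t n)).
  { intros n. apply (@ex_series_le R_AbsRing R_CompleteNormedModule)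
      with (fun j => r ^ j).
    - intros j. change (norm (t n j)) with (Rabs (t n j)).
      rewrite Rabs_pos_eq by (left; apply Ht). unfold t.
      pose proof (rise_neg_bound b (n + j) Hb).
      pose proof (pow_lt r j ltac:(lra)). nra.
    - apply ex_series_geom. rewrite Rabs_pos_eq; lra. }
  set (q := fun n => Series (t n)).
  assert (Hrec : forall n, q n = - rise (- b) (S n) + r * q (S n)).
  { intros n. unfold q. rewrite Series_incr_1 by apply Hex. f_equal.
    - unfold t. rewrite Nat.add_0_r. simpl (r ^ 0). ring.
    - rewrite <- Series_scal_l. apply Series_ext. intros j. unfold t.
      rewrite Nat.add_succ_r. simpl. ring. }
  assert (Hq : forall n, 0 < q n).
  { intros n. rewrite Hrec.
    assert (0 <= q (S n)).
    { unfold q. rewrite <- (Rmult_0_l (Series (fun _ => 0))).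
      rewrite <- Series_scal_l. apply Series_le; [|apply Hex].
      intros j. specialize (Ht (S n) j). lra. }
    pose proof (rise_neg_bound b n Hb). nra. }
  assert (Hs : forall c n, ex_series (fun j => c * t n j)).
  { intros c n. exact (ex_series_scal (V := R_NormedModule) c (t n) (Hex n)). }
  exists q. split; [|split; [|split]].
  - apply functional_extensionality; intros n.
    replace (conv (fsub (rise (-1)) (cst h)) q)
      with (fsub (conv (rise (-1)) q) (conv (cst h) q)) by ring.
    rewrite conv_rise_m1, conv_cst. unfold fsub, fadd, fopp.
    destruct n as [|n].
    (* Only the constant coefficient involves h^b, as the sum of the binomial series at r; the
       others are the recursion [Hrec]. *)
    + assert (H := is_series_unique _ _ (binomial_series b r Hb ltac:(lra))).
      rewrite Series_incr_1 in H
        by (eexists; apply binomial_series; lra).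
      assert (Hq0 : Series (fun k => rise (- b) (S k) * r ^ S k) = - r * q O).
      { unfold q. rewrite <- Series_scal_l. apply Series_ext. intros j.
        unfold t. cbn [Nat.add pow]. ring. }
      rewrite Hq0 in H. unfold r in H at 3. simpl in H |- *.
      replace (1 - (1 - h)) with h in H by ring. rewrite <- H. unfold r. ring.
    + simpl (cst _ (S n)). rewrite (Hrec n). unfold r. ring.
  - exact Hq.
  - intros n. apply Series_le; [|apply Hex]. intros j.
    split; [left; apply Ht|]. unfold t. simpl Nat.add.
    pose proof (rise_neg_decr b (n + j) Hb).
    pose proof (pow_lt r j ltac:(lra)). nra.
  - intros n.
    assert (Hqp : forall x,
      0 <= q n * x ^ 2 - 2 * q (S n) * x + q (S (S n))).
    { intros x.
      replace (q n * x ^ 2 - 2 * q (S n) * x + q (S (S n)))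
        with (Series (fun j => x ^ 2 * t n j + (-2 * x) * t (S n) j + t (S (S n)) j)).
      2:{ rewrite !Series_plus, !Series_scal_l by
            (repeat apply (ex_series_plus (V := R_NormedModule)); auto).
          unfold q. ring. }
      rewrite <- (Rmult_0_l (Series (fun _ => 0))), <- Series_scal_l.
      apply Series_le.
      - intros j. split; [lra|]. rewrite Rmult_0_l.
        assert (H := rise_neg_log_convex b (n + j) x Hb).
        pose proof (pow_lt r j ltac:(lra)). unfold t. simpl Nat.add.
        replace (x ^ 2 * (- rise (- b) (S (n + j)) * r ^ j) +
          -2 * x * (- rise (- b) (S (S (n + j))) * r ^ j) +
          - rise (- b) (S (S (S (n + j)))) * r ^ j)
          with (r ^ j * (- rise (- b) (S (n + j)) * x ^ 2
            - 2 * - rise (- b) (S (S (n + j))) * x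
            + - rise (- b) (S (S (S (n + j)))))) by ring.
        apply Rmult_le_pos; lra.
      - repeat apply (ex_series_plus (V := R_NormedModule)); auto. }
    assert (H0 := Hq n).
    (* The minimiser of the quadratic, where its value is q_(n+2) - q_(n+1)^2 / q_n. *)
    specialize (Hqp (q (S n) / q n)).
    apply Rmult_le_compat_l with (r := q n) in Hqp; [|lra].
    field_simplify in Hqp; [|lra]. nra.
Qed.

(** * The discretised Mittag-Leffler function *)

Lemma ex_series_poly_geom a p x :
  0 < a -> 0 < x < 1 -> ex_series (fun k => (1 + a * INR k) ^ p * x ^ k).
Proof.
  intros Ha Hx.
  assert (Hln : ln x < 0) by (rewrite <- ln_1; apply ln_increasing; lra).
  assert (Hap : 0 <= a * INR p) by (pose proof (pos_INR p); nra).
  (* Chosen so that exp (e a p) x < 1: the p-th power is absorbed by a slightly larger ratio, and e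
     <= 1 gives 1 + t <= (1 + e t) / e. The summand 1 in the denominator covers p = 0 and makes the
     inequality strict. *)
  set (e := Rmin 1 (- ln x / (a * INR p + 1))).
  assert (He1 : e <= 1) by apply Rmin_l.
  assert (He2 : e * (a * INR p + 1) <= - ln x).
  { apply Rle_trans with (- ln x / (a * INR p + 1) * (a * INR p + 1)).
    - apply Rmult_le_compat_r; [lra|apply Rmin_r].
    - right; field; lra. }
  assert (He0 : 0 < e)
    by (apply Rmin_glb_lt; [lra|apply Rdiv_lt_0_compat; lra]).
  set (y := exp (e * (a * INR p)) * x).
  assert (Hy : 0 < y < 1).
  { unfold y. split; [apply Rmult_lt_0_compat; [apply exp_pos|lra]|].
    rewrite <- (exp_ln x) by lra. rewrite <- exp_plus, <- exp_0.
    apply exp_increasing. nra. }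
  apply (@ex_series_le R_AbsRing R_CompleteNormedModule)
    with (fun k => (/ e) ^ p * y ^ k).
  - intros k. pose proof (pos_INR k).
    assert (Hak : 0 <= a * INR k) by nra.
    match goal with |- norm ?u <= _ => change (norm u) with (Rabs u) end.
    rewrite Rabs_pos_eq
      by (apply Rmult_le_pos; apply pow_le; lra).
    unfold y. rewrite Rpow_mult_distr, <- Rmult_assoc.
    apply Rmult_le_compat_r; [apply pow_le; lra|].
    assert (Hexp : exp (e * (a * INR p)) ^ k = exp (e * (a * INR k)) ^ p).
    { rewrite <- !Rpower_pow by apply exp_pos. unfold Rpower.
      rewrite !ln_exp. f_equal. ring. }
    rewrite Hexp, <- Rpow_mult_distr. apply pow_incr.
    split; [lra|]. apply Rmult_le_reg_l with e; [lra|].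
    rewrite <- Rmult_assoc, Rinv_r, Rmult_1_l by lra.
    apply Rle_trans with (1 + e * (a * INR k)); [nra|apply exp_ineq1_le].
  - apply (ex_series_scal (V := R_NormedModule)).
    apply ex_series_geom. rewrite Rabs_pos_eq; lra.
Qed.

(** The series A, its expansion in powers of (h / y)^a being summed coefficient by coefficient; h <
    1 makes the sums over k converge. *)
Definition renewal (a h : R) : nat -> R :=
  fun n => Series (fun k => Rpower h (a * INR k) * rise (a * INR k + 1) n).

Lemma Rpower_mult_INR h a k : Rpower h (a * INR k) = Rpower h a ^ k.
Proof. rewrite <- Rpower_mult, Rpower_pow; [reflexivity|apply exp_pos]. Qed.

Lemma Rpower_lt_1 h a : 0 < h < 1 -> 0 < a -> 0 < Rpower h a < 1.
Proof.
  intros Hh Ha. split; [apply exp_pos|]. unfold Rpower.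
  rewrite <- exp_0. apply exp_increasing.
  assert (ln h < 0) by (rewrite <- ln_1; apply ln_increasing; lra). nra.
Qed.

Lemma ex_series_renewal a h n :
  0 < a -> 0 < h < 1 ->
  ex_series (fun k => Rpower h (a * INR k) * rise (a * INR k + 1) n).
Proof.
  intros Ha Hh.
  apply (@ex_series_le R_AbsRing R_CompleteNormedModule)
    with (fun k => (1 + a * INR k) ^ n * Rpower h a ^ k).
  - intros k. pose proof (pos_INR k).
    assert (Hak : 0 <= a * INR k) by nra.
    match goal with |- norm ?u <= _ => change (norm u) with (Rabs u) end.
    assert (Hp : 0 < Rpower h (a * INR k)) by apply exp_pos.
    assert (Hr : 0 < rise (a * INR k + 1) n) by (apply rise_pos; lra).
    rewrite Rabs_pos_eq by nra.
    rewrite <- Rpower_mult_INR, Rmult_comm.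
    apply Rmult_le_compat_r; [lra|]. apply rise_le; lra.
  - apply ex_series_poly_geom; [exact Ha|]. apply Rpower_lt_1; assumption.
Qed.

(** A coefficient of a product is a finite combination of coefficients of the second factor, so it
    commutes with the summation over k. *)
Lemma conv_is_series d (u : nat -> nat -> R) A n :
  (forall m, is_series (fun k => u k m) (A m)) ->
  is_series (fun k => conv d (u k) n) (conv d A n).
Proof.
  intros Hu. revert d; induction n as [|n IH]; intros d.
  - simpl. exact (is_series_scal (V := R_NormedModule) (d O) _ _ (Hu O)).
  - rewrite conv_S.
    apply (is_series_plus (V := R_NormedModule)); [|apply IH].
    exact (is_series_scal (V := R_NormedModule) (d O) _ _ (Hu (S n))).
Qed.

Lemma conv_rise_renewal a h s n :
  0 < a -> 0 < h < 1 ->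
  is_series (fun k => Rpower h (a * INR k) * rise (a * INR k + 1 + s) n)
    (conv (rise s) (renewal a h) n).
Proof.
  intros Ha Hh.
  apply is_series_ext with (fun k => conv (rise s)
    (fun m => Rpower h (a * INR k) * rise (a * INR k + 1) m) n).
  - intros k. rewrite conv_scal_r, conv_rise. do 2 f_equal. ring.
  - apply conv_is_series. intros m.
    apply Series_correct, ex_series_renewal; assumption.
Qed.

(** Telescoping of the geometric series: multiplication by y^a turns the term k + 1 into h^a times
    the term k, and only y^a times the term 0, that is y^(a-1), survives. *)
Lemma renewal_eq a h :
  0 < a -> 0 < h < 1 ->
  conv (fsub (rise (- a)) (cst (Rpower h a))) (renewal a h) = rise (1 - a).
Proof.
  intros Ha Hh.
  replace (conv (fsub (rise (- a)) (cst (Rpower h a))) (renewal a h))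
    with (fsub (conv (rise (- a)) (renewal a h))
               (conv (cst (Rpower h a)) (renewal a h))) by ring.
  apply functional_extensionality; intros n. unfold fsub, fadd, fopp.
  rewrite conv_cst.
  assert (H := conv_rise_renewal a h (- a) n Ha Hh).
  apply is_series_unique in H. rewrite <- H.
  rewrite Series_incr_1
    by (eexists; apply conv_rise_renewal; assumption).
  unfold renewal. rewrite <- Series_scal_l.
  replace (rise (1 - a) n)
    with (Rpower h (a * INR 0) * rise (a * INR 0 + 1 + - a) n).
  2:{ rewrite Rpower_mult_INR. simpl. rewrite Rmult_1_l. f_equal. ring. }
  rewrite Rplus_assoc. rewrite <- (Rplus_0_r (_ * _)) at 2. f_equal.
  apply Rminus_diag_eq, Series_ext. intros k.
  rewrite !Rpower_mult_INR. simpl (_ ^ S k). rewrite S_INR.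
  rewrite Rmult_assoc. do 3 f_equal. ring.
Qed.

Lemma cst_mult r s : conv (cst r) (cst s) = cst (r * s).
Proof.
  rewrite conv_cst. apply functional_extensionality; intros [|n]; simpl; ring.
Qed.

Lemma cst_cancel r a b :
  r <> 0 -> conv (cst r) a = conv (cst r) b -> a = b.
Proof.
  intros Hr H. rewrite !conv_cst in H.
  apply functional_extensionality; intros n.
  apply (f_equal (fun s => s n)) in H. cbv beta in H.
  apply Rmult_eq_reg_l with r; assumption.
Qed.

(* [y (y - h) A - (y - h)], where the polynomial [y - h] only affects the
   coefficients of index 0 and 1. *)
Definition curvature (a h : R) : nat -> R :=
  fsub (conv (rise (-1)) (conv (fsub (rise (-1)) (cst h)) (renewal a h)))
       (fsub (rise (-1)) (cst h)).

(** Here d is (y^a - h^a) / (y - h), in whatever form it is available: y (y - h) A d = y y^(a-1) =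
    y^a, and subtracting (y - h) d = y^a - h^a leaves h^a. *)
Lemma curvature_eq a h d :
  0 < a -> 0 < h < 1 ->
  conv (fsub (rise (-1)) (cst h)) d = fsub (rise (- a)) (cst (Rpower h a)) ->
  conv (curvature a h) d = cst (Rpower h a).
Proof.
  intros Ha Hh Hd. unfold curvature.
  set (y := rise (-1)) in *. set (A := renewal a h).
  transitivity (fsub (conv y (conv (conv (fsub y (cst h)) d) A))
                     (conv (fsub y (cst h)) d)); [ring|].
  rewrite Hd. unfold A. rewrite renewal_eq by assumption.
  unfold y. rewrite conv_rise. replace (-1 + (1 - a)) with (- a) by ring. ring.
Qed.

Lemma curvature_neg a h n :
  0 < a < 1 -> 0 < h < 1 -> curvature a h (S n) <= 0.
Proof.
  intros Ha Hh.
  destruct (divided_difference a h Ha Hh) as (q & Hq & Hp & _ & Hc).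
  apply (recip_log_convex q _ Hp Hc (Rpower h a)); [left; apply exp_pos|].
  apply curvature_eq; [lra|exact Hh|exact Hq].
Qed.

Lemma slope_nonneg a h n :
  0 < a < 1 -> 0 < h < 1 ->
  0 <= conv (fsub (rise (-1)) (cst h)) (renewal a h) n.
Proof.
  intros Ha Hh.
  destruct (divided_difference (1 - a) h ltac:(lra) Hh) as (q & Hq & Hp & _).
  assert (Hpa := Rpower_lt_1 h a Hh ltac:(lra)).
  assert (Hh2 : Rpower h a * Rpower h (1 - a) = h).
  { rewrite <- Rpower_plus. replace (a + (1 - a)) with 1 by ring.
    apply Rpower_1; lra. }
  assert (Hq0 : (1 - h) * q O = 1 - Rpower h (1 - a))
    by exact (f_equal (fun s => s O) Hq).
  revert n.
  apply (recip_nonneg (fsub (cst 1) (conv (cst (Rpower h a)) q)) _ 1).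
  - unfold fsub, fadd, fopp. rewrite conv_cst. simpl.
    (* Multiplied by 1 - h, the constant term 1 - h^a q_0 becomes 1 - h^a. *)
    apply Rmult_lt_reg_l with (1 - h); [lra|].
    replace ((1 - h) * (1 + - (Rpower h a * q O)))
      with (1 - h - Rpower h a * ((1 - h) * q O)) by ring.
    rewrite Hq0. nra.
  - intros n. unfold fsub, fadd, fopp. rewrite conv_cst. simpl.
    specialize (Hp (S n)). nra.
  - lra.
  - set (y := rise (-1)) in *. set (A := renewal a h).
    (* (y - h) (1 - h^a q) = y - h^a y^(1-a) = y^(1-a) (y^a - h^a), and the last factor times A is
       y^(a-1). *)
    transitivity (conv (fsub (fsub y (cst h))
      (conv (cst (Rpower h a)) (conv (fsub y (cst h)) q))) A); [ring|].
    rewrite Hq. rewrite <- Hh2 at 1. rewrite <- cst_mult.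
    replace y with (conv (rise (- a)) (rise (- (1 - a)))).
    2:{ unfold y. rewrite conv_rise. f_equal. ring. }
    transitivity (conv (rise (- (1 - a)))
      (conv (fsub (rise (- a)) (cst (Rpower h a))) A)); [ring|].
    unfold A. rewrite renewal_eq by lra.
    rewrite conv_rise, <- rise_0. f_equal. ring.
Qed.

(** Multiplication by y differences the coefficients of q_b, so their decrease makes those of y q_b
    + h^b nonpositive after the first. This series is again (y^a - h^a) / (y - h), so [curvature_eq]
    applies. *)
Lemma curvature_nonneg a h n :
  1 < a < 2 -> 0 < h < 1 -> 0 <= curvature a h n.
Proof.
  intros Ha Hh. set (b := a - 1).
  destruct (divided_difference b h ltac:(unfold b; lra) Hh)
    as (q & Hq & Hp & Hd & _).
  assert (Hh2 : h * Rpower h b = Rpower h a).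
  { rewrite <- (Rpower_1 h) at 1 by lra. rewrite <- Rpower_plus.
    f_equal. unfold b; ring. }
  assert (Hpb : 0 < Rpower h b) by apply exp_pos.
  revert n.
  apply (recip_nonneg (fadd (conv (rise (-1)) q) (cst (Rpower h b))) _ (Rpower h a)).
  - unfold fadd. simpl. specialize (Hp O). lra.
  - intros n. unfold fadd. rewrite conv_rise_m1. simpl. specialize (Hd n). lra.
  - left; apply exp_pos.
  - rewrite conv_comm. apply curvature_eq; [lra|exact Hh|].
    set (y := rise (-1)) in *.
    transitivity (fadd (conv y (conv (fsub y (cst h)) q))
      (conv (fsub y (cst h)) (cst (Rpower h b)))); [ring|].
    rewrite Hq.
    transitivity (fsub (conv y (rise (- b))) (conv (cst h) (cst (Rpower h b))));
      [ring|].
    rewrite cst_mult, Hh2. unfold y. rewrite conv_rise. do 2 f_equal. unfold b; ring.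
Qed.

Lemma slope_nonpos a h n :
  1 < a < 2 -> 0 < h < 1 ->
  conv (fsub (rise (-1)) (cst h)) (renewal a h) (S n) <= 0.
Proof.
  intros Ha Hh. set (b := a - 1). assert (Hb : 0 < b < 1) by (unfold b; lra).
  destruct (divided_difference b h Hb Hh) as (q & Hq & Hp & _).
  assert (Hh2 : h * Rpower h b = Rpower h a).
  { rewrite <- (Rpower_1 h) at 1 by lra. rewrite <- Rpower_plus.
    f_equal. unfold b; ring. }
  assert (Hpb : 0 < Rpower h b) by apply exp_pos.
  (* The quotient h^b / q_b is at hand as [curvature b h], and since b < 1 its coefficients after
     the first are known to be nonpositive. *)
  set (X := curvature b h).
  assert (HX : conv X q = cst (Rpower h b))
    by (apply curvature_eq; [lra|exact Hh|exact Hq]).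
  assert (HXneg : forall m, X (S m) <= 0)
    by (intros m; apply curvature_neg; assumption).
  assert (HX0 : X O * q O = Rpower h b) by exact (f_equal (fun s => s O) HX).
  set (y := rise (-1)) in *. set (A := renewal a h).
  set (V := fsub (cst 1) (conv (fsub y (cst h)) A)).
  (* [V = h / (y + h^b / q)] *)
  assert (HV : conv (fadd y X) V = cst h).
  (* Writing h^b as X q reduces the claim to its multiple by q. There (y q + h^b) (y - h) = y^a -
     h^a, so (y q + h^b) V = y q + h^b - y^b = h q. *)
  { apply cst_cancel with (Rpower h b); [lra|]. rewrite <- HX.
    transitivity (conv X (conv (fadd (conv q y) (conv X q)) V)); [ring|].
    transitivity (conv X (conv q (cst h))); [|ring]. f_equal.
    rewrite HX. unfold V.
    transitivity (fsub (fadd (conv q y) (cst (Rpower h b)))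
      (conv (fadd (conv y (conv (fsub y (cst h)) q))
                  (conv (cst (Rpower h b)) (fsub y (cst h)))) A)); [ring|].
    rewrite Hq.
    replace (fadd (conv y (fsub (rise (- b)) (cst (Rpower h b))))
                  (conv (cst (Rpower h b)) (fsub y (cst h))))
      with (fsub (conv y (rise (- b))) (conv (cst h) (cst (Rpower h b)))) by ring.
    rewrite cst_mult, Hh2. unfold y at 2. rewrite conv_rise.
    replace (-1 + - b) with (- a) by (unfold b; ring).
    unfold A. rewrite renewal_eq by lra.
    replace (1 - a) with (- b) by (unfold b; ring).
    transitivity (fsub (conv q y) (fsub (rise (- b)) (cst (Rpower h b)))); [ring|].
    rewrite <- Hq. ring. }
  assert (HVn : 0 <= V (S n)).
  { apply (recip_nonneg (fadd y X) V h); [| |lra|exact HV].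
    - unfold fadd, y. simpl. specialize (Hp O). nra.
    - intros [|m]; unfold fadd, y.
      + specialize (HXneg O). simpl in *. lra.
      + rewrite rise_m1 by lia. specialize (HXneg (S m)). lra. }
  unfold V, fsub at 1, fadd at 1, fopp at 1 in HVn. simpl (cst 1 (S n)) in HVn. lra.
Qed.

(** * The Gamma function *)

(** The exponent is shifted by one: the integral over (0, infinity) is Gamma (b + 1), the form in
    which Gamma occurs in the Mittag-Leffler series. *)
Definition gamma_density (b t : R) : R := Rpower t b * exp (- t).

Lemma gamma_density_pos b t : 0 < gamma_density b t.
Proof. apply Rmult_lt_0_compat; apply exp_pos. Qed.

Lemma gamma_density_derive b t :
  0 < t ->
  is_derive (gamma_density b) t
    (b * gamma_density (b - 1) t - gamma_density b t).
Proof.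
  intros Ht. unfold gamma_density, Rpower.
  auto_derive; [exact Ht|].
  replace ((b - 1) * ln t) with (b * ln t + - ln t) by ring.
  rewrite exp_plus, (exp_Ropp (ln t)), exp_ln by exact Ht. field. lra.
Qed.

Lemma gamma_density_continuous b t :
  0 < t -> continuous (gamma_density b) t.
Proof.
  intros Ht. apply (ex_derive_continuous (gamma_density b)).
  eexists. apply gamma_density_derive, Ht.
Qed.

Lemma gamma_density_ex_RInt b u v :
  0 < u -> 0 < v -> ex_RInt (gamma_density b) u v.
Proof.
  intros Hu Hv. apply (ex_RInt_continuous (V := R_CompleteNormedModule)).
  intros t Ht. apply gamma_density_continuous.
  apply Rlt_le_trans with (Rmin u v); [apply Rmin_glb_lt; lra|lra].
Qed.

Lemma gamma_density_bound b :
  0 <= b ->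
  exists C, 0 < C /\ forall t, 0 < t -> gamma_density b t <= C * exp (- (t / 2)).
Proof.
  (* From ln v <= v at v = t / (2 b + 1) one gets b ln t <= b ln (2 b + 1) + t / 2; the summand 1
     keeps the divisor positive at b = 0. *)
  intros Hb. exists (exp (b * ln (2 * b + 1))). split; [apply exp_pos|].
  intros t Ht. unfold gamma_density, Rpower. rewrite <- !exp_plus.
  assert (Hexp : forall x y, x <= y -> exp x <= exp y).
  { intros x y [H| ->]; [left; apply exp_increasing, H|right; reflexivity]. }
  apply Hexp.
  assert (Hl : ln t <= ln (2 * b + 1) + t / (2 * b + 1)).
  { assert (Hq : 0 < t / (2 * b + 1)) by (apply Rdiv_lt_0_compat; lra).
    assert (H := exp_ineq1_le (ln (t / (2 * b + 1)))).
    rewrite exp_ln in H by exact Hq.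
    unfold Rdiv at 1 in H. rewrite ln_mult in H;
      [|exact Ht|apply Rinv_0_lt_compat; lra].
    rewrite ln_Rinv in H by lra. lra. }
  assert (Hm : b * (t / (2 * b + 1)) <= t / 2).
  { apply Rmult_le_reg_r with (2 * (2 * b + 1)); [lra|].
    field_simplify; nra. }
  nra.
Qed.

Lemma gamma_density_RInt_bound b :
  0 <= b ->
  exists M, forall u v, 0 < u -> u <= v -> RInt (gamma_density b) u v <= M.
Proof.
  intros Hb. destruct (gamma_density_bound b Hb) as (C & HC & H).
  exists (2 * C). intros u v Hu Huv.
  assert (Hi : is_RInt (fun t => C * exp (- (t / 2))) u v
                 (- 2 * C * exp (- (v / 2)) - (- 2 * C * exp (- (u / 2))))).
  { apply (is_RInt_derive (fun t => - 2 * C * exp (- (t / 2)))).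
    - intros t _. auto_derive; [trivial|]. unfold Rdiv; field.
    - intros t _. apply (ex_derive_continuous (fun t => C * exp (- (t / 2)))).
      auto_derive. trivial. }
  apply Rle_trans with (RInt (fun t => C * exp (- (t / 2))) u v).
  - apply RInt_le; [exact Huv|apply gamma_density_ex_RInt; lra| |].
    + eexists; exact Hi.
    + intros t Ht. apply H. lra.
  - rewrite (is_RInt_unique _ _ _ _ Hi).
    assert (0 < exp (- (v / 2))) by apply exp_pos.
    assert (exp (- (u / 2)) < 1)
      by (rewrite <- exp_0; apply exp_increasing; lra). nra.
Qed.

Lemma filter_prod_half_line (P : R * R -> Prop) u0 v0 :
  0 < u0 -> u0 <= v0 ->
  (forall u v, 0 < u < u0 -> v0 < v -> P (u, v)) ->
  filter_prod (at_right 0) (Rbar_locally p_infty) P.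
Proof.
  intros Hu0 Huv H.
  apply Filter_prod with (fun u => 0 < u < u0) (fun v => v0 < v).
  - exists (mkposreal u0 Hu0). intros u Hu Hpos. split; [exact Hpos|].
    change (Rabs (u - 0) < u0) in Hu. apply Rabs_def2 in Hu. lra.
  - exists v0. intros v Hv; exact Hv.
  - exact H.
Qed.

(** [RInt_gen] is a total function, so convergence has to be established. The integrand is positive,
    hence the integrals over [u, v] grow with the interval; they are bounded, and their supremum is
    the limit. *)
Lemma Gamma_correct b :
  0 <= b ->
  is_RInt_gen (gamma_density b) (at_right 0) (Rbar_locally p_infty) (Gamma (b + 1)).
Proof.
  intros Hb.
  replace (Gamma (b + 1))
    with (RInt_gen (gamma_density b) (at_right 0) (Rbar_locally p_infty)).
  2:{ unfold Gamma, gamma_density. replace (b + 1 - 1) with b by ring. reflexivity. }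
  apply (RInt_gen_correct (V := R_CompleteNormedModule)).
  destruct (gamma_density_RInt_bound b Hb) as (M & HM).
  destruct (completeness (fun y => exists u v, 0 < u /\ u <= v /\
              y = RInt (gamma_density b) u v)) as (l & Hub & Hlub).
  - exists M. intros y (u & v & Hu & Huv & ->). apply HM; assumption.
  - exists (RInt (gamma_density b) 1 1), 1, 1. repeat split; lra.
  - exists l. intros P (eps & HP).
    destruct (Classical_Prop.classic (exists u v, 0 < u /\ u <= v /\
                l - eps < RInt (gamma_density b) u v)) as [H|H].
    + destruct H as (u0 & v0 & Hu0 & Huv0 & Hl).
      unfold filtermapi. apply filter_prod_half_line with u0 v0; try assumption.
      intros u v Hu Hv. simpl fst; simpl snd.
      exists (RInt (gamma_density b) u v). split.
      * apply (RInt_correct (V := R_CompleteNormedModule)).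
        apply gamma_density_ex_RInt; lra.
      * apply HP. change (Rabs (RInt (gamma_density b) u v - l) < eps).
        assert (Hge : forall x y, 0 < x -> x <= y -> 0 <= RInt (gamma_density b) x y).
        { intros x y Hx Hxy.
          apply RInt_ge_0; [exact Hxy|apply gamma_density_ex_RInt; lra|].
          intros t _. left; apply gamma_density_pos. }
        assert (H1 := RInt_Chasles (V := R_CompleteNormedModule) (gamma_density b) u u0 v
          (gamma_density_ex_RInt b u u0 ltac:(lra) ltac:(lra))
          (gamma_density_ex_RInt b u0 v ltac:(lra) ltac:(lra))).
        assert (H2 := RInt_Chasles (V := R_CompleteNormedModule) (gamma_density b) u0 v0 v
          (gamma_density_ex_RInt b u0 v0 ltac:(lra) ltac:(lra))
          (gamma_density_ex_RInt b v0 v ltac:(lra) ltac:(lra))).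
        unfold plus in H1, H2; simpl in H1, H2.
        assert (H3 := Hge u u0 ltac:(lra) ltac:(lra)).
        assert (H4 := Hge v0 v ltac:(lra) ltac:(lra)).
        assert (H5 : RInt (gamma_density b) u v <= l).
        { apply Hub. exists u, v. repeat split; lra. }
        assert (Heps := cond_pos eps).
        apply Rabs_def1; lra.
    + exfalso. assert (Heps := cond_pos eps).
      assert (l <= l - eps); [|lra]. apply Hlub.
      intros y (u & v & Hu & Huv & ->). apply Rnot_lt_le. intros Hy.
      apply H. exists u, v. auto.
Qed.

(** Fundamental theorem of calculus on (0, infinity), with boundary values taken as limits. *)
Lemma Gamma_correct_Derive f df la lb :
  (forall t, 0 < t -> is_derive f t (df t)) ->
  (forall t, 0 < t -> continuous df t) ->
  filterlim f (at_right 0) (locally la) ->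
  filterlim f (Rbar_locally p_infty) (locally lb) ->
  is_RInt_gen df (at_right 0) (Rbar_locally p_infty) (lb - la).
Proof.
  intros Hd Hc H0 Hinf.
  apply (is_RInt_gen_ext (V := R_NormedModule) (Derive f)).
  - apply filter_prod_half_line with 1 1; [lra..|].
    intros u v Hu Hv t Ht. simpl in Ht. rewrite Rmin_left in Ht by lra.
    apply is_derive_unique, Hd. lra.
  - apply is_RInt_gen_Derive; [| |exact H0|exact Hinf];
      apply filter_prod_half_line with 1 1; [lra..| |lra|lra|];
      intros u v Hu Hv t Ht; simpl in Ht; rewrite Rmin_left in Ht by lra.
    + eexists. apply Hd. lra.
    + apply (continuous_ext_loc _ df).
      * exists (mkposreal t ltac:(lra)). intros y Hy.
        change (Rabs (y - t) < t) in Hy. apply Rabs_def2 in Hy.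
        symmetry. apply is_derive_unique, Hd. lra.
      * apply Hc. lra.
Qed.

(** Multiplied by t, the density becomes the one for b + 1, which is bounded; so it is at most C /
    t. *)
Lemma gamma_density_lim_infty b :
  0 <= b -> filterlim (gamma_density b) (Rbar_locally p_infty) (locally 0).
Proof.
  intros Hb. destruct (gamma_density_bound (b + 1) ltac:(lra)) as (C & HC & H).
  intros P (eps & HP). assert (Heps := cond_pos eps).
  exists (C / eps). intros t Ht.
  assert (Hq : 0 < C / eps) by (apply Rdiv_lt_0_compat; lra).
  assert (Ht0 : 0 < t) by lra.
  apply HP. change (Rabs (gamma_density b t - 0) < eps).
  rewrite Rminus_0_r, Rabs_pos_eq by (left; apply gamma_density_pos).
  assert (H1 : gamma_density (b + 1) t = t * gamma_density b t).
  { unfold gamma_density. rewrite Rpower_plus, Rpower_1 by exact Ht0. ring. }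
  specialize (H t Ht0). rewrite H1 in H.
  assert (exp (- (t / 2)) < 1) by (rewrite <- exp_0; apply exp_increasing; lra).
  apply Rmult_lt_reg_l with t; [exact Ht0|].
  apply Rlt_trans with C; [nra|].
  apply Rmult_lt_compat_r with (r := eps) in Ht; [|lra].
  unfold Rdiv in Ht. rewrite Rmult_assoc, Rinv_l in Ht by lra. lra.
Qed.

Lemma gamma_density_lim_0 b :
  0 <= b -> filterlim (gamma_density (b + 1)) (at_right 0) (locally 0).
Proof.
  intros Hb P (eps & HP). assert (Heps := cond_pos eps).
  assert (Hm : 0 < Rmin 1 eps) by (apply Rmin_glb_lt; lra).
  exists (mkposreal _ Hm). intros t Ht Hpos.
  change (Rabs (t - 0) < Rmin 1 eps) in Ht.
  rewrite Rminus_0_r, Rabs_pos_eq in Ht by lra.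
  assert (H1 := Rmin_l 1 eps). assert (H2 := Rmin_r 1 eps).
  apply HP. change (Rabs (gamma_density (b + 1) t - 0) < eps).
  rewrite Rminus_0_r, Rabs_pos_eq by (left; apply gamma_density_pos).
  unfold gamma_density. rewrite Rpower_plus, Rpower_1 by exact Hpos.
  assert (Hb1 : Rpower t b <= 1).
  { destruct Hb as [Hb|<-].
    - left. apply Rpower_lt_1; lra.
    - unfold Rpower. rewrite Rmult_0_l, exp_0. lra. }
  assert (0 < Rpower t b) by apply exp_pos.
  assert (0 < exp (- t) < 1).
  { split; [apply exp_pos|]. rewrite <- exp_0. apply exp_increasing. lra. }
  assert (Rpower t b * t <= t) by nra.
  assert (0 < Rpower t b * t) by nra. nra.
Qed.

Lemma Gamma_1 : Gamma 1 = 1.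
Proof.
  replace 1 with (0 + 1) at 1 by ring.
  assert (H : is_RInt_gen (gamma_density 0) (at_right 0) (Rbar_locally p_infty)
                (0 - - 1)).
  { apply (Gamma_correct_Derive (fun t => - gamma_density 0 t)).
    - intros t Ht. evar_last.
      + apply (is_derive_opp (V := R_NormedModule)), gamma_density_derive, Ht.
      + unfold opp; simpl. ring.
    - intros t Ht. apply gamma_density_continuous, Ht.
    - apply (filterlim_ext (fun t => - exp (- t))).
      + intros t. unfold gamma_density, Rpower. rewrite Rmult_0_l, exp_0. ring.
      + assert (Hc : continuous (fun t => - exp (- t)) 0)
          by (apply (ex_derive_continuous (fun t => - exp (- t)));
              auto_derive; trivial).
        unfold continuous in Hc. rewrite Ropp_0, exp_0 in Hc.
        intros P HP. apply (filter_imp (F := locally 0)) with (2 := Hc P HP).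
        trivial.
    - rewrite <- Ropp_0. eapply filterlim_comp;
        [apply gamma_density_lim_infty; lra|].
      apply (filterlim_opp (V := R_NormedModule)). }
  assert (H1 := Gamma_correct 0 ltac:(lra)).
  apply (is_RInt_gen_unique (V := R_CompleteNormedModule)) in H.
  apply (is_RInt_gen_unique (V := R_CompleteNormedModule)) in H1. lra.
Qed.

(** Integration by parts: t^(b+1) e^(-t) vanishes at both ends, so its derivative has integral
    zero. *)
Lemma Gamma_succ b : 0 <= b -> Gamma (b + 1 + 1) = (b + 1) * Gamma (b + 1).
Proof.
  intros Hb.
  assert (H : is_RInt_gen
      (fun t => (b + 1) * gamma_density b t - gamma_density (b + 1) t)
      (at_right 0) (Rbar_locally p_infty) (0 - 0)).
  { apply (Gamma_correct_Derive (gamma_density (b + 1))).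
    - intros t Ht. evar_last; [apply gamma_density_derive, Ht|].
      replace (b + 1 - 1) with b by ring. reflexivity.
    - intros t Ht. apply (continuous_minus (V := R_NormedModule)).
      + apply (continuous_scal_r (V := R_NormedModule)), gamma_density_continuous, Ht.
      + apply gamma_density_continuous, Ht.
    - apply gamma_density_lim_0, Hb.
    - apply gamma_density_lim_infty. lra. }
  assert (H1 := is_RInt_gen_minus (V := R_NormedModule) _ _ _ _
    (is_RInt_gen_scal (V := R_NormedModule) (Fa := at_right 0)
        (Fb := Rbar_locally p_infty) _ (b + 1) _ (Gamma_correct b Hb))
    (Gamma_correct (b + 1) ltac:(lra))).
  apply (is_RInt_gen_unique (V := R_CompleteNormedModule)) in H.
  apply (is_RInt_gen_unique (V := R_CompleteNormedModule)) in H1.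
  unfold minus, plus, opp, scal in H1; simpl in H1; unfold mult in H1; simpl in H1.
  change (RInt_gen (fun t => (b + 1) * gamma_density b t - gamma_density (b + 1) t)
    (at_right 0) (Rbar_locally p_infty) =
    (b + 1) * Gamma (b + 1) + - Gamma (b + 1 + 1)) in H1.
  lra.
Qed.

(** * Young's inequality and Gauss's limit formula *)

Lemma Young_Rpower s u : 0 <= s <= 1 -> 0 < u -> Rpower u s <= 1 + s * (u - 1).
Proof.
  intros Hs Hu. set (L := ln u).
  assert (HL : u = exp (s * L) * exp ((1 - s) * L)).
  { rewrite <- exp_plus. replace (s * L + (1 - s) * L) with L by ring.
    symmetry. apply exp_ln, Hu. }
  assert (H0 : 1 = exp (s * L) * exp (- (s * L)))
    by (rewrite <- exp_plus, Rplus_opp_r, exp_0; reflexivity).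
  assert (H1 := exp_ineq1_le ((1 - s) * L)).
  assert (H2 := exp_ineq1_le (- (s * L))).
  unfold Rpower. fold L. set (p := exp (s * L)) in *.
  assert (Hp : 0 < p) by apply exp_pos.
  (* With p = u^s, p is the weighted mean of p (1 - s L) and p (1 + (1 - s) L), in which the terms
     in L cancel; the tangent bound for exp makes these at most 1 and u. *)
  apply Rle_trans with
    ((1 - s) * (p * (1 + - (s * L))) + s * (p * (1 + (1 - s) * L)));
    [right; ring|].
  assert (p * (1 + - (s * L)) <= 1)
    by (rewrite H0; apply Rmult_le_compat_l; lra).
  assert (p * (1 + (1 - s) * L) <= u)
    by (rewrite HL; apply Rmult_le_compat_l; lra).
  nra.
Qed.

(** Stands in for the log-convexity of Gamma: t^s <= m^s (1 - s + s t / m) is integrated against t^m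
    e^(-t). *)
Lemma Gamma_Young m s :
  0 < m -> 0 <= s <= 1 ->
  Gamma (m + s + 1) <= Rpower m s * (1 + s / m) * Gamma (m + 1).
Proof.
  intros Hm Hs. set (c := Rpower m s). assert (Hc : 0 < c) by apply exp_pos.
  assert (Hi := is_RInt_gen_plus (V := R_NormedModule) (Fa := at_right 0)
    (Fb := Rbar_locally p_infty) _ _ _ _
    (is_RInt_gen_scal (V := R_NormedModule) (Fa := at_right 0)
        (Fb := Rbar_locally p_infty) _ (c * (1 - s)) _
      (Gamma_correct m ltac:(lra)))
    (is_RInt_gen_scal (V := R_NormedModule) (Fa := at_right 0)
        (Fb := Rbar_locally p_infty) _ (c * s / m) _
      (Gamma_correct (m + 1) ltac:(lra)))).
  assert (H : norm (Gamma (m + s + 1)) <=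
    c * (1 - s) * Gamma (m + 1) + c * s / m * Gamma (m + 1 + 1)).
  { apply (RInt_gen_norm (V := R_CompleteNormedModule)
      (Fa := at_right 0) (Fb := Rbar_locally p_infty))
      with (3 := Gamma_correct (m + s) ltac:(lra)) (4 := Hi);
      apply filter_prod_half_line with 1 1; try lra; intros u v Hu Hv; simpl fst; simpl snd;
      [lra|].
    intros t Ht. change (Rabs (gamma_density (m + s) t) <=
      c * (1 - s) * gamma_density m t + c * s / m * gamma_density (m + 1) t).
    rewrite Rabs_pos_eq by (left; apply gamma_density_pos).
    unfold gamma_density. rewrite !Rpower_plus, Rpower_1 by lra.
    assert (HY := Young_Rpower s (t / m) Hs ltac:(apply Rdiv_lt_0_compat; lra)).
    assert (Ht' : Rpower t s = c * Rpower (t / m) s).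
    { unfold c. rewrite Rpower_mult_distr by (try apply Rdiv_lt_0_compat; lra).
      f_equal. field. lra. }
    rewrite Ht'.
    assert (0 < Rpower t m * exp (- t)) by (apply Rmult_lt_0_compat; apply exp_pos).
    replace (c * (1 - s) * (Rpower t m * exp (- t)) +
             c * s / m * (Rpower t m * t * exp (- t)))
      with (Rpower t m * exp (- t) * (c * (1 + s * (t / m - 1)))) by (field; lra).
    replace (Rpower t m * (c * Rpower (t / m) s) * exp (- t))
      with (Rpower t m * exp (- t) * (c * Rpower (t / m) s)) by ring.
    apply Rmult_le_compat_l; [lra|]. apply Rmult_le_compat_l; lra. }
  apply Rle_trans with (1 := Rle_abs _). apply Rle_trans with (1 := H).
  rewrite Gamma_succ by lra. right. field. lra.
Qed.

Lemma rise_1 n : rise 1 n = 1.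
Proof.
  induction n as [|n IH]; [reflexivity|]. cbn [rise]. rewrite IH, S_INR.
  pose proof (pos_INR n). field. lra.
Qed.

Lemma Gamma_rise b n :
  0 <= b -> Gamma (b + INR n + 1) = INR (fact n) * rise (b + 1) n * Gamma (b + 1).
Proof.
  intros Hb; induction n as [|n IH].
  - simpl. rewrite Rplus_0_r. ring.
  - pose proof (pos_INR n). rewrite S_INR.
    replace (b + (INR n + 1) + 1) with (b + INR n + 1 + 1) by ring.
    rewrite Gamma_succ, IH by lra. cbn [rise]. rewrite fact_simpl, mult_INR.
    rewrite S_INR. field. lra.
Qed.

Lemma Gamma_INR n : Gamma (INR n + 1) = INR (fact n).
Proof.
  assert (H := Gamma_rise 0 n ltac:(lra)).
  rewrite !Rplus_0_l, rise_1, Gamma_1 in H. rewrite H. ring.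
Qed.

Lemma rise_Gamma_upper b n :
  0 <= b <= 1 -> (1 <= n)%nat ->
  rise (b + 1) n * Gamma (b + 1) <= Rpower (INR n) b * (1 + b / INR n).
Proof.
  intros Hb Hn. assert (HN := lt_0_INR n ltac:(lia)).
  assert (Hf : 0 < INR (fact n)) by apply INR_fact_lt_0.
  assert (H := Gamma_Young (INR n) b HN Hb).
  rewrite Gamma_INR in H.
  replace (INR n + b + 1) with (b + INR n + 1) in H by ring.
  rewrite Gamma_rise in H by lra. nra.
Qed.

(** [Gamma_Young] is applied over the complementary step 1 - b, from n + b to n + 1. Its factor 1 +
    (1 - b) / (n + b) equals (n + 1) / (n + b), and n + 1 cancels against (n + 1)!, which leaves the
    lower bound (n + b)^b >= n^b. *)
Lemma rise_Gamma_lower b n :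
  0 <= b <= 1 -> (1 <= n)%nat ->
  Rpower (INR n) b <= rise (b + 1) n * Gamma (b + 1).
Proof.
  intros Hb Hn. assert (HN := lt_0_INR n ltac:(lia)).
  assert (Hf : 0 < INR (fact n)) by apply INR_fact_lt_0.
  assert (H := Gamma_Young (INR n + b) (1 - b) ltac:(lra) ltac:(lra)).
  replace (INR n + b + (1 - b) + 1) with (INR (S n) + 1) in H
    by (rewrite S_INR; ring).
  rewrite Gamma_INR, fact_simpl, mult_INR, S_INR in H.
  replace (INR n + b + 1) with (b + INR n + 1) in H by ring.
  rewrite Gamma_rise in H by lra.
  set (g := rise (b + 1) n * Gamma (b + 1)) in *.
  assert (Hp : Rpower (INR n + b) (1 - b) * Rpower (INR n + b) b = INR n + b).
  { rewrite <- Rpower_plus. replace (1 - b + b) with 1 by ring.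
    apply Rpower_1; lra. }
  assert (Hle := Rle_Rpower_l (INR n) (INR n + b) b ltac:(lra) ltac:(lra)).
  apply Rle_trans with (1 := Hle).
  set (p := Rpower (INR n + b) (1 - b)) in *.
  set (q := Rpower (INR n + b) b) in *.
  assert (Hp0 : 0 < p) by apply exp_pos.
  replace (INR (fact n) * rise (b + 1) n * Gamma (b + 1))
    with (INR (fact n) * g) in H by (unfold g; ring).
  replace (p * (1 + (1 - b) / (INR n + b)) * (INR (fact n) * g))
    with ((INR n + 1) * INR (fact n) * (g / q)) in H.
  2:{ assert (Hq0 : 0 < q) by apply exp_pos.
      assert (Hp' : p = (INR n + b) / q) by (rewrite <- Hp; field; lra).
      rewrite Hp'. field. lra. }
  assert (Hq0 : 0 < q) by apply exp_pos.
  assert (H1 : 1 <= g / q).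
  { apply Rmult_le_reg_l with ((INR n + 1) * INR (fact n)); [nra|]. lra. }
  apply Rmult_le_compat_r with (r := q) in H1; [|lra].
  unfold Rdiv in H1. rewrite Rmult_assoc, Rinv_l in H1; lra.
Qed.

(* Gauss's limit formula. *)
Lemma Gamma_Gauss b :
  0 <= b ->
  0 < Gamma (b + 1) /\
  is_lim_seq (fun n => Rpower (INR n) (- b) * rise (b + 1) n) (/ Gamma (b + 1)).
Proof.
  intros Hb.
  (* Induction on an integer m with b <= m + 1: the two-sided bounds squeeze the case b <= 1, and
     each further unit comes from the functional equation. *)
  assert (Hm : exists m, b <= INR m + 1).
  { destruct (nfloor_ex b Hb) as (m & Hm). exists m. lra. }
  destruct Hm as (m & Hm). revert b Hb Hm.
  induction m as [|m IH]; intros b Hb Hm.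
  - simpl in Hm. assert (Hb1 : 0 <= b <= 1) by lra.
    assert (HG : 0 < Gamma (b + 1)).
    (* Positivity of Gamma is read off the lower bound at n = 1. *)
    { assert (H := rise_Gamma_lower b 1 Hb1 (le_n 1)).
      assert (H1 : 0 < Rpower (INR 1) b) by apply exp_pos.
      assert (H2 := rise_pos (b + 1) 1 ltac:(lra)). nra. }
    split; [exact HG|].
    apply is_lim_seq_ext_loc with
      (fun n => / Gamma (b + 1) *
         (Rpower (INR n) (- b) * (rise (b + 1) n * Gamma (b + 1)))).
    { exists O. intros n _. field. lra. }
    replace (Finite (/ Gamma (b + 1))) with (Rbar_mult (/ Gamma (b + 1)) 1)
      by (simpl; f_equal; ring).
    apply is_lim_seq_scal_l.
    apply is_lim_seq_le_le_loc with (fun _ => 1) (fun n => 1 + b * / INR n).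
    + exists 1%nat. intros n Hn. assert (HN := lt_0_INR n ltac:(lia)).
      assert (Hp : Rpower (INR n) (- b) * Rpower (INR n) b = 1).
      { rewrite <- Rpower_plus, Rplus_opp_l. apply Rpower_O, HN. }
      assert (H1 := rise_Gamma_lower b n Hb1 Hn).
      assert (H2 := rise_Gamma_upper b n Hb1 Hn).
      assert (0 < Rpower (INR n) (- b)) by apply exp_pos.
      rewrite <- Hp at 1. split.
      * apply Rmult_le_compat_l; lra.
      * apply Rle_trans with
          (Rpower (INR n) (- b) * (Rpower (INR n) b * (1 + b / INR n))).
        -- apply Rmult_le_compat_l; lra.
        -- rewrite <- Rmult_assoc, Hp. right. unfold Rdiv. ring.
    + apply is_lim_seq_const.
    + replace (Finite 1) with (Finite (1 + b * 0)) by (f_equal; ring).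
      apply is_lim_seq_plus'; [apply is_lim_seq_const|].
      apply (is_lim_seq_scal_l (fun n => / INR n) b 0).
      replace (Finite 0) with (Rbar_inv p_infty) by reflexivity.
      apply is_lim_seq_inv; [apply is_lim_seq_INR|discriminate].
  - destruct (Rle_lt_dec b 1) as [Hb1|Hb1].
    { apply IH; [exact Hb|]. pose proof (pos_INR m). lra. }
    rewrite S_INR in Hm. set (c := b - 1).
    destruct (IH c ltac:(unfold c; lra) ltac:(unfold c; lra)) as (HG & Hl).
    assert (Hbc : b = c + 1) by (unfold c; ring).
    assert (HGs : Gamma (b + 1) = b * Gamma (c + 1)).
    { rewrite Hbc at 1. rewrite Gamma_succ by (unfold c; lra).
      rewrite <- Hbc. reflexivity. }
    rewrite HGs. split; [apply Rmult_lt_0_compat; lra|].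
    apply is_lim_seq_ext_loc with
      (fun n => (Rpower (INR n) (- c) * rise (c + 1) n) * (/ INR n + / b)).
    { exists 1%nat. intros n Hn. assert (HN := lt_0_INR n ltac:(lia)).
      assert (Hr := rise_succ b n). rewrite Hbc in Hr at 2.
      replace (rise b n) with (rise (c + 1) n) in Hr by (f_equal; lra).
      replace (rise (c + 1 + 1) n) with (rise (b + 1) n) in Hr by (do 2 f_equal; lra).
      replace (rise (b + 1) n) with ((b + INR n) * rise (c + 1) n / b)
        by (rewrite <- Hr; field; lra).
      replace (- b) with (- c + - (1)) by lra.
      rewrite Rpower_plus, (Rpower_Ropp _ 1), Rpower_1 by exact HN.
      field. lra. }
    replace (/ (b * Gamma (c + 1))) with (/ Gamma (c + 1) * (0 + / b))
      by (field; lra).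
    apply is_lim_seq_mult'; [exact Hl|].
    apply is_lim_seq_plus'; [|apply is_lim_seq_const].
    replace (Finite 0) with (Rbar_inv p_infty) by reflexivity.
    apply is_lim_seq_inv; [apply is_lim_seq_INR|discriminate].
Qed.

(** The quotient of consecutive values is (1 + b / (n + 1)) / (1 + 1 / n)^b, and (1 + 1 / n)^b >= 1
    + b ln (1 + 1 / n) >= 1 + b / (n + 1). This monotonicity supplies the dominating sequence: the
    value at a fixed N bounds all later ones. *)
Lemma Gauss_decr b n :
  0 <= b -> (1 <= n)%nat ->
  Rpower (INR (S n)) (- b) * rise (b + 1) (S n) <=
  Rpower (INR n) (- b) * rise (b + 1) n.
Proof.
  intros Hb Hn. assert (HN := lt_0_INR n ltac:(lia)).
  assert (Hr := rise_pos (b + 1) n ltac:(lra)).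
  assert (Hs := rise_S (b + 1) n). rewrite S_INR in *.
  set (N := INR n) in *.
  assert (Hln : / (N + 1) <= ln ((N + 1) / N)).
  { replace ((N + 1) / N) with (/ (1 - / (N + 1))) by (field; lra).
    assert (0 < / (N + 1) < 1).
    { split; [apply Rinv_0_lt_compat; lra|].
      rewrite <- Rinv_1. apply Rinv_lt_contravar; lra. }
    rewrite ln_Rinv by lra.
    assert (H0 := exp_ineq1_le (ln (1 - / (N + 1)))).
    rewrite exp_ln in H0 by lra. lra. }
  assert (Hp : 1 + b / (N + 1) <= Rpower ((N + 1) / N) b).
  { apply Rle_trans with (1 + b * ln ((N + 1) / N)); [|apply exp_ineq1_le].
    unfold Rdiv at 1. nra. }
  assert (Hq : Rpower N (- b) = Rpower (N + 1) (- b) * Rpower ((N + 1) / N) b).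
  { replace (Rpower (N + 1) (- b)) with (Rpower ((N + 1) / N) (- b) * Rpower N (- b)).
    - rewrite Rmult_comm, <- Rmult_assoc, <- Rpower_plus, Rplus_opp_r.
      rewrite Rpower_O by (apply Rdiv_lt_0_compat; lra). ring.
    - rewrite Rpower_mult_distr by (try apply Rdiv_lt_0_compat; lra).
      f_equal. field. lra. }
  rewrite Hq.
  replace (rise (b + 1) (S n)) with ((1 + b / (N + 1)) * rise (b + 1) n).
  2:{ apply Rmult_eq_reg_l with (N + 1); [|lra]. rewrite Hs. field. lra. }
  assert (0 < Rpower (N + 1) (- b)) by apply exp_pos.
  rewrite Rmult_assoc. apply Rmult_le_compat_l; [lra|].
  apply Rmult_le_compat_r; lra.
Qed.

Lemma Gauss_antitone b N m :
  0 <= b -> (1 <= N)%nat ->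
  Rpower (INR (m + N)) (- b) * rise (b + 1) (m + N) <=
  Rpower (INR N) (- b) * rise (b + 1) N.
Proof.
  intros Hb HN. induction m as [|m IH]; [simpl; lra|].
  apply Rle_trans with (2 := IH). apply Gauss_decr; [exact Hb|lia].
Qed.

Lemma is_lim_seq_sum_f_R0 (u : nat -> nat -> R) (v : nat -> R) m :
  (forall k, is_lim_seq (fun n => u n k) (v k)) ->
  is_lim_seq (fun n => sum_f_R0 (u n) m) (sum_f_R0 v m).
Proof.
  intros H. induction m as [|m IH]; [apply H|]. simpl.
  apply is_lim_seq_plus'; [exact IH|apply H].
Qed.

(* Tannery's theorem. *)
Lemma Series_dominated_lim (u : nat -> nat -> R) (v M : nat -> R) :
  (forall n k, Rabs (u n k) <= M k) -> ex_series M ->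
  (forall k, is_lim_seq (fun n => u n k) (v k)) ->
  is_lim_seq (fun n => Series (u n)) (Series v).
Proof.
  intros Hu HM Hv.
  assert (HvM : forall k, Rabs (v k) <= M k).
  { intros k. assert (H := is_lim_seq_abs _ _ (Hv k)).
    exact (is_lim_seq_le _ _ _ _ (fun n => Hu n k) H (is_lim_seq_const (M k))). }
  assert (Hexu : forall n, ex_series (u n))
    by (intros n; apply (@ex_series_le R_AbsRing R_CompleteNormedModule) with M;
        [apply Hu|exact HM]).
  assert (Hexv : ex_series v)
    by (apply (@ex_series_le R_AbsRing R_CompleteNormedModule) with M;
        [apply HvM|exact HM]).
  assert (Htail : forall w m, (forall k, Rabs (w k) <= M k) ->
    Rabs (Series w - sum_f_R0 w m) <= Series M - sum_f_R0 M m).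
  { intros w m Hw.
    assert (Hexw : ex_series w)
      by (apply (@ex_series_le R_AbsRing R_CompleteNormedModule) with M;
          [apply Hw|exact HM]).
    rewrite (Series_incr_n w (S m)) by (try lia; exact Hexw).
    rewrite (Series_incr_n M (S m)) by (try lia; exact HM). simpl pred.
    replace (_ + _ - _) with (Series (fun k => w (S m + k)%nat)) by ring.
    replace (_ + _ - _) with (Series (fun k => M (S m + k)%nat)) by ring.
    assert (HMt : ex_series (fun k => M (S m + k)%nat))
      by (apply (ex_series_incr_n (V := R_NormedModule) M); exact HM).
    assert (Hwt : ex_series (fun k => Rabs (w (S m + k)%nat))).
    { apply (@ex_series_le R_AbsRing R_CompleteNormedModule)
        with (fun k => M (S m + k)%nat); [|exact HMt].
      intros k. change (Rabs (Rabs (w (S m + k)%nat)) <= M (S m + k)%nat).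
      rewrite Rabs_Rabsolu. apply Hw. }
    apply Rle_trans with (Series (fun k => Rabs (w (S m + k)%nat))).
    - apply Series_Rabs, Hwt.
    - apply Series_le; [|exact HMt]. intros k. split; [apply Rabs_pos|apply Hw]. }
  apply is_lim_seq_spec. intros eps. assert (Heps := cond_pos eps).
  assert (HMl : is_lim_seq (sum_n M) (Series M)) by (apply Series_correct, HM).
  apply is_lim_seq_spec in HMl.
  destruct (HMl (mkposreal (eps / 3) ltac:(lra))) as (m & Hm).
  specialize (Hm m (le_n m)). simpl in Hm. rewrite sum_n_Reals in Hm.
  assert (Hs := is_lim_seq_sum_f_R0 u v m Hv).
  apply is_lim_seq_spec in Hs.
  destruct (Hs (mkposreal (eps / 3) ltac:(lra))) as (n0 & Hn0).
  exists n0. intros n Hn. specialize (Hn0 n Hn). simpl in Hn0.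
  assert (H1 := Htail (u n) m (Hu n)). assert (H2 := Htail v m HvM).
  apply Rabs_def2 in Hm. apply Rabs_def2 in Hn0.
  apply Rabs_le_between in H1. apply Rabs_le_between in H2.
  apply Rabs_def1; lra.
Qed.

(** * Passage to the limit *)

Definition renewal_term (a x : R) (n k : nat) : R :=
  Rpower (x / INR n) (a * INR k) * rise (a * INR k + 1) n.

Definition ml_term (a x : R) (k : nat) : R :=
  Rpower x (a * INR k) / Gamma (a * INR k + 1).

Lemma renewal_term_eq a x n k :
  0 < x -> (1 <= n)%nat ->
  renewal_term a x n k =
  Rpower x (a * INR k) *
    (Rpower (INR n) (- (a * INR k)) * rise (a * INR k + 1) n).
Proof.
  intros Hx Hn. assert (HN := lt_0_INR n ltac:(lia)).
  unfold renewal_term. rewrite <- Rmult_assoc. f_equal.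
  unfold Rdiv. rewrite <- Rpower_mult_distr by (try apply Rinv_0_lt_compat; lra).
  f_equal. unfold Rpower. rewrite ln_Rinv by lra. f_equal. ring.
Qed.

Lemma renewal_term_lim a x k :
  0 < a -> 0 < x -> is_lim_seq (fun n => renewal_term a x n k) (ml_term a x k).
Proof.
  intros Ha Hx. pose proof (pos_INR k).
  assert (Hb : 0 <= a * INR k) by nra.
  apply is_lim_seq_ext_loc with (fun n => Rpower x (a * INR k) *
    (Rpower (INR n) (- (a * INR k)) * rise (a * INR k + 1) n)).
  - exists 1%nat. intros n Hn. symmetry. apply renewal_term_eq; assumption.
  - apply (is_lim_seq_scal_l _ (Rpower x (a * INR k)) (/ Gamma (a * INR k + 1))).
    apply Gamma_Gauss, Hb.
Qed.

Lemma exists_nat_above x : exists N, (2 <= N)%nat /\ x < INR N.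
Proof.
  destruct (nfloor_ex (Rmax x 0) (Rmax_r _ _)) as (N & _ & HN).
  exists (S (S N)). split; [lia|]. rewrite !S_INR.
  assert (H := Rmax_l x 0). lra.
Qed.

(** The term at N dominates all later ones; for x < N the bound is a polynomial in k times a
    geometric sequence of ratio (x / N)^a < 1. *)
Lemma renewal_term_bound a x N m k :
  0 < a -> 0 < x -> (1 <= N)%nat ->
  0 <= renewal_term a x (m + N) k <=
  (1 + a * INR k) ^ N * Rpower (x / INR N) a ^ k.
Proof.
  intros Ha Hx HN. pose proof (pos_INR k).
  assert (Hb : 0 <= a * INR k) by nra. split.
  - apply Rmult_le_pos; left; [apply exp_pos|apply rise_pos; lra].
  - apply Rle_trans with (renewal_term a x N k).
    + rewrite !renewal_term_eq by (try lia; assumption).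
      apply Rmult_le_compat_l; [left; apply exp_pos|].
      apply Gauss_antitone; assumption.
    + unfold renewal_term. rewrite Rpower_mult_INR, Rmult_comm.
      apply Rmult_le_compat_r; [apply pow_le; left; apply exp_pos|].
      apply rise_le, Hb.
Qed.

Lemma ex_series_renewal_bound a x N p :
  0 < a -> 0 < x < INR N ->
  ex_series (fun k => (1 + a * INR k) ^ p * Rpower (x / INR N) a ^ k).
Proof.
  intros Ha Hx. apply ex_series_poly_geom; [exact Ha|].
  apply Rpower_lt_1; [|exact Ha]. split; [apply Rdiv_lt_0_compat; lra|].
  apply Rmult_lt_reg_r with (INR N); [lra|].
  unfold Rdiv. rewrite Rmult_assoc, Rinv_l; lra.
Qed.

(** One limit theorem for f, f' and f'': differences in z act on the terms as weights [phi] of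
    polynomial growth in k, with p = 0, 1 and 2. *)
Lemma renewal_series_lim a x p C (phi : nat -> nat -> R) (psi : nat -> R) :
  0 < a -> 0 < x -> 0 <= C ->
  (forall n k, (2 <= n)%nat -> Rabs (phi n k) <= C * (1 + a * INR k) ^ p) ->
  (forall k, is_lim_seq (fun n => phi n k) (psi k)) ->
  is_lim_seq (fun n => Series (fun k => renewal_term a x n k * phi n k))
    (Series (fun k => ml_term a x k * psi k)).
Proof.
  intros Ha Hx HC Hphi Hlim. destruct (exists_nat_above x) as (N & HN2 & HN).
  apply (is_lim_seq_incr_n _ N).
  apply (Series_dominated_lim
    (fun m k => renewal_term a x (m + N) k * phi (m + N)%nat k) _
    (fun k => C * ((1 + a * INR k) ^ (N + p) * Rpower (x / INR N) a ^ k))).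
  - intros m k. rewrite Rabs_mult, pow_add.
    assert (H := renewal_term_bound a x N m k Ha Hx ltac:(lia)).
    rewrite Rabs_pos_eq by apply H.
    assert (H1 := Hphi (m + N)%nat k ltac:(lia)).
    replace (C * ((1 + a * INR k) ^ N * (1 + a * INR k) ^ p * Rpower (x / INR N) a ^ k))
      with ((1 + a * INR k) ^ N * Rpower (x / INR N) a ^ k * (C * (1 + a * INR k) ^ p))
      by ring.
    apply Rmult_le_compat; [apply H|apply Rabs_pos|apply H|exact H1].
  - apply (ex_series_scal (V := R_NormedModule)), ex_series_renewal_bound; [exact Ha|lra].
  - intros k. apply is_lim_seq_mult'.
    + apply (is_lim_seq_incr_n (fun n => renewal_term a x n k) N).
      apply renewal_term_lim; assumption.
    + apply (is_lim_seq_incr_n (fun n => phi n k) N), Hlim.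
Qed.

Lemma renewal_lim_0 a x :
  0 < a -> 0 < x ->
  is_lim_seq (fun n => renewal a (x / INR n) n) (Series (ml_term a x)).
Proof.
  intros Ha Hx.
  replace (Series (ml_term a x)) with (Series (fun k => ml_term a x k * 1))
    by (apply Series_ext; intros; ring).
  apply is_lim_seq_ext with
    (fun n => Series (fun k => renewal_term a x n k * 1)).
  - intros n. apply Series_ext. intros k. unfold renewal_term. ring.
  - apply (renewal_series_lim a x 0 1 (fun _ _ => 1) (fun _ => 1)); try lra.
    + intros n k _. rewrite Rabs_R1. simpl. lra.
    + intros k. apply is_lim_seq_const.
Qed.

(* [rise (s - 1) n / h = rise s n * drop (s - 1) x n] for [h = x / n]. *)
Definition drop (s x : R) (n : nat) : R := s * INR n / (x * (s + INR n)).

Lemma rise_drop s x n :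
  0 < x -> (1 <= n)%nat -> 0 < s + INR n ->
  INR n / x * rise s n = rise (s + 1) n * drop s x n.
Proof.
  intros Hx Hn Hs. assert (H := rise_succ s n). unfold drop.
  apply Rmult_eq_reg_r with (x * (s + INR n)); [|apply Rgt_not_eq, Rmult_lt_0_compat; lra].
  transitivity (INR n * ((s + INR n) * rise s n)); [field; lra|].
  rewrite <- H. field. lra.
Qed.

Lemma drop_lim s x : 0 < x -> is_lim_seq (drop s x) (s / x).
Proof.
  intros Hx. apply is_lim_seq_ext_loc with (fun n => s / x * / (s * / INR n + 1)).
  - destruct (exists_nat_above (- s)) as (N & HN2 & HN).
    exists N. intros n Hn. assert (H := le_INR _ _ Hn).
    assert (H1 := lt_0_INR n ltac:(lia)). unfold drop. field. repeat split; lra.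
  - replace (Finite (s / x)) with (Finite (s / x * / (s * 0 + 1)))
      by (f_equal; field; lra).
    apply (is_lim_seq_scal_l _ (s / x) (/ (s * 0 + 1))).
    apply (is_lim_seq_inv _ (s * 0 + 1)).
    + apply is_lim_seq_plus'; [|apply is_lim_seq_const].
      apply (is_lim_seq_scal_l _ s 0).
      replace (Finite 0) with (Rbar_inv p_infty) by reflexivity.
      apply is_lim_seq_inv; [apply is_lim_seq_INR|discriminate].
    + intros H. apply (f_equal real) in H. simpl in H. lra.
Qed.

(** The point is n / (s + n) <= 2, valid for s >= -1 once n >= 2; s = -1 occurs in the second
    difference at k = 0. *)
Lemma drop_bound s x n b :
  0 < x -> (2 <= n)%nat -> -1 <= s -> Rabs s <= b ->
  Rabs (drop s x n) <= 2 / x * b.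
Proof.
  intros Hx Hn Hs Hb. assert (HN := le_INR _ _ Hn). simpl in HN.
  unfold drop. replace (s * INR n / (x * (s + INR n)))
    with (s * (/ x * (INR n / (s + INR n)))) by (field; lra).
  rewrite Rabs_mult, (Rabs_pos_eq (_ * _)).
  2:{ apply Rmult_le_pos; [left; apply Rinv_0_lt_compat; lra|].
      apply Rdiv_le_0_compat; lra. }
  rewrite Rmult_comm. apply Rmult_le_compat; [|apply Rabs_pos| |exact Hb].
  - apply Rmult_le_pos; [left; apply Rinv_0_lt_compat; lra|].
    apply Rdiv_le_0_compat; lra.
  - unfold Rdiv at 2. rewrite (Rmult_comm 2). apply Rmult_le_compat_l.
    + left; apply Rinv_0_lt_compat; lra.
    + apply Rmult_le_reg_r with (s + INR n); [lra|].
      unfold Rdiv. rewrite Rmult_assoc, Rinv_l; lra.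
Qed.

Lemma eventually_step x :
  0 < x -> eventually (fun n => (2 <= n)%nat /\ 0 < x / INR n < 1).
Proof.
  intros Hx. destruct (exists_nat_above x) as (N & HN2 & HN).
  exists N. intros n Hn. assert (H := le_INR _ _ Hn). split; [lia|].
  split; [apply Rdiv_lt_0_compat; lra|].
  apply Rmult_lt_reg_r with (INR n); [lra|].
  unfold Rdiv. rewrite Rmult_assoc, Rinv_l; lra.
Qed.

(** Passing from A to y A / h multiplies the term k by [drop (a * INR k) x n], which tends to a k /
    x: the limit is the termwise derivative of the series for f. *)
Lemma renewal_lim_1 a x :
  0 < a -> 0 < x ->
  is_lim_seq
    (fun n => INR n / x * conv (rise (-1)) (renewal a (x / INR n)) n)
    (Series (fun k => ml_term a x k * (a * INR k / x))).
Proof.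
  intros Ha Hx.
  apply is_lim_seq_ext_loc with (fun n =>
    Series (fun k => renewal_term a x n k * drop (a * INR k) x n)).
  - destruct (eventually_step x Hx) as (N & HN). exists N. intros n Hn.
    destruct (HN n Hn) as (Hn2 & Hh).
    rewrite <- (is_series_unique _ _ (conv_rise_renewal a _ (-1) n Ha Hh)).
    rewrite <- Series_scal_l. apply Series_ext. intros k.
    pose proof (pos_INR k). assert (HN1 := lt_0_INR n ltac:(lia)).
    replace (a * INR k + 1 + -1) with (a * INR k) by ring.
    unfold renewal_term. rewrite Rmult_assoc, <- rise_drop; [ring|lra|lia|nra].
  - apply (renewal_series_lim a x 1 (2 / x)
      (fun n k => drop (a * INR k) x n) (fun k => a * INR k / x)); try assumption.
    + left; apply Rdiv_lt_0_compat; lra.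
    + intros n k Hn. pose proof (pos_INR k). assert (0 <= a * INR k) by nra.
      rewrite pow_1. apply drop_bound; try assumption; [lra|].
      rewrite Rabs_pos_eq; lra.
    + intros k. apply drop_lim, Hx.
Qed.

Lemma renewal_lim_2 a x :
  0 < a -> 0 < x ->
  is_lim_seq
    (fun n => INR n / x * (INR n / x *
       conv (rise (-1)) (conv (rise (-1)) (renewal a (x / INR n))) n))
    (Series (fun k => ml_term a x k * (a * INR k / x * ((a * INR k - 1) / x)))).
Proof.
  intros Ha Hx.
  apply is_lim_seq_ext_loc with (fun n =>
    Series (fun k => renewal_term a x n k *
      (drop (a * INR k) x n * drop (a * INR k - 1) x n))).
  - destruct (eventually_step x Hx) as (N & HN). exists N. intros n Hn.
    destruct (HN n Hn) as (Hn2 & Hh). rewrite conv_assoc, conv_rise.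
    rewrite <- (is_series_unique _ _ (conv_rise_renewal a _ (-1 + -1) n Ha Hh)).
    rewrite <- !Series_scal_l. apply Series_ext. intros k.
    pose proof (pos_INR k). assert (HN1 := le_INR _ _ Hn2). simpl in HN1.
    assert (0 <= a * INR k) by nra.
    assert (H1 := rise_drop (a * INR k) x n Hx ltac:(lia) ltac:(lra)).
    assert (H2 := rise_drop (a * INR k - 1) x n Hx ltac:(lia) ltac:(lra)).
    replace (a * INR k - 1 + 1) with (a * INR k) in H2 by ring.
    replace (a * INR k + 1 + (-1 + -1)) with (a * INR k - 1) by ring.
    unfold renewal_term.
    transitivity (Rpower (x / INR n) (a * INR k) *
      (rise (a * INR k + 1) n * drop (a * INR k) x n) * drop (a * INR k - 1) x n);
      [ring|].
    rewrite <- H1.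
    transitivity (Rpower (x / INR n) (a * INR k) * (INR n / x) *
      (rise (a * INR k) n * drop (a * INR k - 1) x n)); [ring|].
    rewrite <- H2. ring.
  - apply (renewal_series_lim a x 2 (2 / x * (2 / x))
      (fun n k => drop (a * INR k) x n * drop (a * INR k - 1) x n)
      (fun k => a * INR k / x * ((a * INR k - 1) / x))); try assumption.
    + assert (0 < 2 / x) by (apply Rdiv_lt_0_compat; lra). nra.
    + intros n k Hn. pose proof (pos_INR k). assert (0 <= a * INR k) by nra.
      rewrite Rabs_mult.
      replace (2 / x * (2 / x) * (1 + a * INR k) ^ 2)
        with ((2 / x * (1 + a * INR k)) * (2 / x * (1 + a * INR k))) by ring.
      apply Rmult_le_compat; try apply Rabs_pos; apply drop_bound;
        try assumption; try lra; apply Rabs_le; lra.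
    + intros k. apply is_lim_seq_mult'; apply drop_lim, Hx.
Qed.

Lemma slope_eval a h n :
  conv (fsub (rise (-1)) (cst h)) (renewal a h) n =
  conv (rise (-1)) (renewal a h) n - h * renewal a h n.
Proof.
  replace (conv (fsub (rise (-1)) (cst h)) (renewal a h))
    with (fsub (conv (rise (-1)) (renewal a h)) (conv (cst h) (renewal a h))) by ring.
  unfold fsub, fadd, fopp. rewrite conv_cst. ring.
Qed.

Lemma curvature_eval a h n :
  (2 <= n)%nat ->
  curvature a h n =
  conv (rise (-1)) (conv (rise (-1)) (renewal a h)) n
  - h * conv (rise (-1)) (renewal a h) n.
Proof.
  intros Hn. unfold curvature.
  replace (conv (rise (-1)) (conv (fsub (rise (-1)) (cst h)) (renewal a h)))
    with (fsub (conv (rise (-1)) (conv (rise (-1)) (renewal a h)))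
               (conv (cst h) (conv (rise (-1)) (renewal a h)))) by ring.
  unfold fsub, fadd, fopp. rewrite conv_cst, rise_m1 by exact Hn.
  destruct n as [|n]; [lia|]. simpl. ring.
Qed.

Lemma scaled_slope a x n :
  0 < x -> (1 <= n)%nat ->
  INR n / x * conv (rise (-1)) (renewal a (x / INR n)) n
  - renewal a (x / INR n) n =
  INR n / x * conv (fsub (rise (-1)) (cst (x / INR n))) (renewal a (x / INR n)) n.
Proof.
  intros Hx Hn. assert (HN := lt_0_INR n ltac:(lia)).
  rewrite slope_eval. field. lra.
Qed.

Lemma scaled_curvature a x n :
  0 < x -> (2 <= n)%nat ->
  INR n / x * (INR n / x *
    conv (rise (-1)) (conv (rise (-1)) (renewal a (x / INR n))) n)
  - INR n / x * conv (rise (-1)) (renewal a (x / INR n)) n =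
  INR n / x * (INR n / x * curvature a (x / INR n) n).
Proof.
  intros Hx Hn. assert (HN := lt_0_INR n ltac:(lia)).
  rewrite curvature_eval by exact Hn. field. lra.
Qed.

Lemma ml_signs_lt_1 a x :
  0 < a < 1 -> 0 < x ->
  Series (ml_term a x) <= Series (fun k => ml_term a x k * (a * INR k / x)) /\
  Series (fun k => ml_term a x k * (a * INR k / x * ((a * INR k - 1) / x))) <=
  Series (fun k => ml_term a x k * (a * INR k / x)).
Proof.
  intros Ha Hx. destruct (eventually_step x Hx) as (N & HN).
  assert (H0 := renewal_lim_0 a x ltac:(lra) Hx).
  assert (H1 := renewal_lim_1 a x ltac:(lra) Hx).
  assert (H2 := renewal_lim_2 a x ltac:(lra) Hx).
  split.
  - refine (is_lim_seq_le_loc _ _ _ _ _ H0 H1). exists N. intros n Hn.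
    destruct (HN n Hn) as (Hn2 & Hh). assert (HN1 := lt_0_INR n ltac:(lia)).
    assert (E := scaled_slope a x n Hx ltac:(lia)).
    assert (S := slope_nonneg a (x / INR n) n Ha Hh).
    assert (0 < INR n / x) by (apply Rdiv_lt_0_compat; lra). nra.
  - refine (is_lim_seq_le_loc _ _ _ _ _ H2 H1). exists N. intros n Hn.
    destruct (HN n Hn) as (Hn2 & Hh). assert (HN1 := lt_0_INR n ltac:(lia)).
    assert (E := scaled_curvature a x n Hx Hn2).
    assert (S := curvature_neg a (x / INR n) (pred n) Ha Hh).
    rewrite Nat.succ_pred in S by lia.
    assert (0 < INR n / x) by (apply Rdiv_lt_0_compat; lra).
    assert (INR n / x * (INR n / x * curvature a (x / INR n) n) <= 0); [|lra].
    apply Rle_trans with (INR n / x * (INR n / x * 0)); [|right; ring].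
    do 2 (apply Rmult_le_compat_l; [lra|]). exact S.
Qed.

Lemma ml_signs_gt_1 a x :
  1 < a < 2 -> 0 < x ->
  Series (fun k => ml_term a x k * (a * INR k / x)) <= Series (ml_term a x) /\
  Series (fun k => ml_term a x k * (a * INR k / x)) <=
  Series (fun k => ml_term a x k * (a * INR k / x * ((a * INR k - 1) / x))).
Proof.
  intros Ha Hx. destruct (eventually_step x Hx) as (N & HN).
  assert (H0 := renewal_lim_0 a x ltac:(lra) Hx).
  assert (H1 := renewal_lim_1 a x ltac:(lra) Hx).
  assert (H2 := renewal_lim_2 a x ltac:(lra) Hx).
  split.
  - refine (is_lim_seq_le_loc _ _ _ _ _ H1 H0). exists N. intros n Hn.
    destruct (HN n Hn) as (Hn2 & Hh). assert (HN1 := lt_0_INR n ltac:(lia)).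
    assert (E := scaled_slope a x n Hx ltac:(lia)).
    assert (S := slope_nonpos a (x / INR n) (pred n) Ha Hh).
    rewrite Nat.succ_pred in S by lia.
    assert (0 < INR n / x) by (apply Rdiv_lt_0_compat; lra). nra.
  - refine (is_lim_seq_le_loc _ _ _ _ _ H1 H2). exists N. intros n Hn.
    destruct (HN n Hn) as (Hn2 & Hh). assert (HN1 := lt_0_INR n ltac:(lia)).
    assert (E := scaled_curvature a x n Hx Hn2).
    assert (S := curvature_nonneg a (x / INR n) n Ha Hh).
    assert (0 < INR n / x) by (apply Rdiv_lt_0_compat; lra).
    assert (0 <= INR n / x * (INR n / x * curvature a (x / INR n) n)); [|lra].
    repeat (apply Rmult_le_pos; [lra|]). exact S.
Qed.

(** * Derivatives and convexity *)

(** z d/dz on coefficients. The derivative of g(x^a) in x is a / x times (euler g)(x^a), so the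
    shape is preserved under a second differentiation. *)
Definition euler (g : nat -> R) : nat -> R := fun k => INR k * g k.

Lemma euler_PS_derive g : euler g = PS_incr_1 (PS_derive g).
Proof.
  apply functional_extensionality; intros [|k]; [|reflexivity].
  unfold euler. simpl. rewrite Rmult_0_l. reflexivity.
Qed.

Lemma CV_radius_euler g : CV_radius (euler g) = CV_radius g.
Proof. rewrite euler_PS_derive, CV_radius_incr_1. apply CV_radius_derive. Qed.

Lemma is_derive_PSeries_Rpower g a x :
  CV_radius g = p_infty -> 0 < x ->
  is_derive (fun t => PSeries g (Rpower t a)) x
    (a / x * PSeries (euler g) (Rpower x a)).
Proof.
  intros Hg Hx. rewrite euler_PS_derive, PSeries_incr_1. evar_last.
  - apply (is_derive_comp (V := R_NormedModule) (PSeries g) (fun t => Rpower t a)).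
    + apply is_derive_PSeries. rewrite Hg. exact I.
    + unfold Rpower. auto_derive; [exact Hx|reflexivity].
  - unfold scal; simpl; unfold mult; simpl. fold (Rpower x a). field. lra.
Qed.

Definition ml_coeff (a : R) (k : nat) : R := / Gamma (a * INR k + 1).

Lemma ml_coeff_pos a k : 0 < a -> 0 < ml_coeff a k.
Proof.
  intros Ha. pose proof (pos_INR k). apply Rinv_0_lt_compat, Gamma_Gauss. nra.
Qed.

Lemma ml_term_coeff a x k : ml_term a x k = ml_coeff a k * Rpower x a ^ k.
Proof.
  unfold ml_term, ml_coeff, Rdiv. rewrite Rpower_mult_INR. ring.
Qed.

Lemma ml_term_pos a x k : 0 < a -> 0 < ml_term a x k.
Proof.
  intros Ha. rewrite ml_term_coeff.
  apply Rmult_lt_0_compat; [apply ml_coeff_pos, Ha|apply pow_lt, exp_pos].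
Qed.

(** The dominating bound for [renewal_term] passes to the limit and takes the place of a growth
    estimate for Gamma. *)
Lemma ex_series_ml_term a x : 0 < a -> 0 < x -> ex_series (ml_term a x).
Proof.
  intros Ha Hx. destruct (exists_nat_above x) as (N & HN2 & HN).
  apply (@ex_series_le R_AbsRing R_CompleteNormedModule)
    with (fun k => (1 + a * INR k) ^ N * Rpower (x / INR N) a ^ k);
    [|apply ex_series_renewal_bound; [exact Ha|lra]].
  intros k. change (Rabs (ml_term a x k) <=
    (1 + a * INR k) ^ N * Rpower (x / INR N) a ^ k).
  rewrite Rabs_pos_eq by (left; apply ml_term_pos, Ha).
  assert (H := proj1 (is_lim_seq_incr_n (fun n => renewal_term a x n k) N _)
                 (renewal_term_lim a x k Ha Hx)).
  refine (is_lim_seq_le _ _ _ _ _ H (is_lim_seq_const _)).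
  intros m. apply renewal_term_bound; [assumption..|lia].
Qed.

Lemma CV_radius_ml_coeff a : 0 < a -> CV_radius (ml_coeff a) = p_infty.
Proof.
  intros Ha. assert (H : forall r, 0 < r -> Rbar_le r (CV_radius (ml_coeff a))).
  { intros r Hr. apply (proj1 (Lub_Rbar_correct (CV_disk (ml_coeff a)))).
    unfold CV_disk.
    (* Every radius r is (r^(1/a))^a, so the series at r is the one for f at the point r^(1/a). *)
    apply ex_series_ext with (ml_term a (Rpower r (/ a))).
    - intros k. rewrite ml_term_coeff, Rpower_mult, Rinv_l, Rpower_1 by lra.
      rewrite Rabs_pos_eq; [reflexivity|].
      apply Rmult_le_pos; [left; apply ml_coeff_pos, Ha|apply pow_le; lra].
    - apply ex_series_ml_term; [exact Ha|apply exp_pos]. }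
  destruct (CV_radius (ml_coeff a)) as [c| |]; [|reflexivity|].
  - exfalso. specialize (H (Rabs c + 1)). simpl in H.
    pose proof (Rabs_pos c). pose proof (Rle_abs c). lra.
  - exfalso. exact (H 1 Rlt_0_1).
Qed.

Lemma mittag_leffler_PSeries a z : mittag_leffler a z = PSeries (ml_coeff a) z.
Proof. apply Series_ext. intros k. unfold ml_coeff, Rdiv. ring. Qed.

Lemma ml_term_series_0 a x :
  Series (ml_term a x) = PSeries (ml_coeff a) (Rpower x a).
Proof. apply Series_ext. intros k. apply ml_term_coeff. Qed.

Lemma ml_term_series_1 a x :
  Series (fun k => ml_term a x k * (a * INR k / x)) =
  a / x * PSeries (euler (ml_coeff a)) (Rpower x a).
Proof.
  unfold PSeries. rewrite <- Series_scal_l. apply Series_ext. intros k.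
  rewrite ml_term_coeff. unfold euler, Rdiv. ring.
Qed.

Lemma ml_term_series_2 a x :
  0 < a -> 0 < x ->
  Series (fun k => ml_term a x k * (a * INR k / x * ((a * INR k - 1) / x))) =
  a / x * (a / x * PSeries (euler (euler (ml_coeff a))) (Rpower x a))
  - a / x ^ 2 * PSeries (euler (ml_coeff a)) (Rpower x a).
Proof.
  intros Ha Hx. set (g := euler (ml_coeff a)).
  assert (Hg : CV_radius g = p_infty)
    by (unfold g; rewrite CV_radius_euler; apply CV_radius_ml_coeff, Ha).
  assert (Hex : forall d, CV_radius d = p_infty ->
      ex_series (fun k => d k * Rpower x a ^ k)).
  { intros d Hd. apply ex_series_Rabs, CV_disk_inside. rewrite Hd. exact I. }
  rewrite <- Rmult_assoc. unfold PSeries. rewrite <- !Series_scal_l.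
  rewrite <- Series_minus.
  - apply Series_ext. intros k. rewrite ml_term_coeff. unfold g, euler. field. lra.
  - apply (ex_series_scal (V := R_NormedModule) (a / x * (a / x))
      (fun k => euler g k * Rpower x a ^ k)), Hex. rewrite CV_radius_euler. exact Hg.
  - apply (ex_series_scal (V := R_NormedModule) (a / x ^ 2)
      (fun k => g k * Rpower x a ^ k)), Hex, Hg.
Qed.

(** * Second-derivative tests for log-convexity and log-concavity *)

Lemma mvt_between f df x y :
  (forall t, 0 < t -> is_derive f t (df t)) -> 0 < x -> 0 < y ->
  exists c, Rmin x y <= c <= Rmax x y /\ f y - f x = df c * (y - x).
Proof.
  intros Hf Hx Hy. assert (Hm : 0 < Rmin x y) by (apply Rmin_glb_lt; assumption).
  apply MVT_gen.
  - intros t Ht. apply Hf. lra.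
  - intros t Ht. apply derivable_continuous_pt. exists (df t).
    apply is_derive_Reals, Hf. lra.
Qed.

(** The derivative increases, so the graph lies above its tangent at the intermediate point w;
    averaging the tangent bounds at x and y removes the linear term. *)
Lemma convex_pos_of_derive2 f df ddf :
  (forall t, 0 < t -> is_derive f t (df t)) ->
  (forall t, 0 < t -> is_derive df t (ddf t)) ->
  (forall t, 0 < t -> 0 <= ddf t) -> convex_pos f.
Proof.
  intros H1 H2 H3.
  assert (Hmono : forall x y, 0 < x -> x <= y -> df x <= df y).
  { intros x y Hx Hxy.
    destruct (mvt_between df ddf x y H2 Hx ltac:(lra)) as (c & Hc & E).
    rewrite Rmin_left in Hc by lra. assert (0 <= ddf c) by (apply H3; lra). nra. }
  assert (Htan : forall w y, 0 < w -> 0 < y -> df w * (y - w) <= f y - f w).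
  { intros w y Hw Hy.
    destruct (mvt_between f df w y H1 Hw Hy) as (c & Hc & ->).
    destruct (Rle_dec w y) as [Hwy|Hwy].
    - rewrite Rmin_left, Rmax_right in Hc by lra.
      apply Rmult_le_compat_r; [lra|]. apply Hmono; lra.
    - rewrite Rmin_right, Rmax_left in Hc by lra.
      assert (df c <= df w) by (apply Hmono; lra). nra. }
  intros x y t Hx Hy Ht. set (w := t * x + (1 - t) * y).
  assert (Hw : 0 < w).
  { unfold w. destruct (Rle_lt_dec t (1 / 2)); nra. }
  assert (Hwx := Htan w x Hw Hx). assert (Hwy := Htan w y Hw Hy).
  assert (Hz : t * (df w * (x - w)) + (1 - t) * (df w * (y - w)) = 0)
    by (unfold w; ring).
  apply Rmult_le_compat_l with (r := t) in Hwx; [|lra].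
  apply Rmult_le_compat_l with (r := 1 - t) in Hwy; [|lra]. lra.
Qed.

Lemma is_derive_ln_comp f df x :
  0 < f x -> is_derive f x df -> is_derive (fun t => ln (f t)) x (df / f x).
Proof.
  intros Hf Hd. evar_last.
  - apply (is_derive_comp (V := R_NormedModule) ln f); [|exact Hd].
    apply is_derive_Reals, derivable_pt_lim_ln, Hf.
  - reflexivity.
Qed.

Lemma log_convex_of_derive2 f df ddf :
  (forall t, 0 < t -> 0 < f t) ->
  (forall t, 0 < t -> is_derive f t (df t)) ->
  (forall t, 0 < t -> is_derive df t (ddf t)) ->
  (forall t, 0 < t -> df t * df t <= f t * ddf t) -> log_convex_pos f.
Proof.
  intros Hp H1 H2 H. split; [exact Hp|].
  apply (convex_pos_of_derive2 _ (fun t => df t / f t)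
    (fun t => (ddf t * f t - df t * df t) / f t ^ 2)).
  - intros t Ht. apply is_derive_ln_comp; auto.
  - intros t Ht. apply is_derive_div; auto. specialize (Hp t Ht). lra.
  - intros t Ht. specialize (Hp t Ht). specialize (H t Ht).
    apply Rdiv_le_0_compat; [lra|apply pow_lt, Hp].
Qed.

Lemma log_concave_of_derive2 f df ddf :
  (forall t, 0 < t -> 0 < f t) ->
  (forall t, 0 < t -> is_derive f t (df t)) ->
  (forall t, 0 < t -> is_derive df t (ddf t)) ->
  (forall t, 0 < t -> f t * ddf t <= df t * df t) -> log_concave_pos f.
Proof.
  intros Hp H1 H2 H. split; [exact Hp|].
  assert (Hc : convex_pos (fun t => - ln (f t))).
  { apply (convex_pos_of_derive2 _ (fun t => - (df t / f t))
      (fun t => - ((ddf t * f t - df t * df t) / f t ^ 2))).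
    - intros t Ht. apply (is_derive_opp (V := R_NormedModule)).
      apply is_derive_ln_comp; auto.
    - intros t Ht. apply (is_derive_opp (V := R_NormedModule)).
      apply is_derive_div; auto. specialize (Hp t Ht). lra.
    - intros t Ht. specialize (Hp t Ht). specialize (H t Ht).
      replace (- ((ddf t * f t - df t * df t) / f t ^ 2))
        with ((df t * df t - f t * ddf t) / f t ^ 2) by (field; lra).
      apply Rdiv_le_0_compat; [lra|apply pow_lt, Hp]. }
  intros x y t Hx Hy Ht. specialize (Hc x y t Hx Hy Ht). simpl in Hc. lra.
Qed.

(** * The function f and its first two derivatives *)

Lemma ml_derive a x :
  0 < a -> 0 < x ->
  is_derive (fun t => mittag_leffler a (Rpower t a)) x
    (a / x * PSeries (euler (ml_coeff a)) (Rpower x a)).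
Proof.
  intros Ha Hx.
  apply (is_derive_ext (fun t => PSeries (ml_coeff a) (Rpower t a))).
  - intros t. symmetry. apply mittag_leffler_PSeries.
  - apply is_derive_PSeries_Rpower; [apply CV_radius_ml_coeff, Ha|exact Hx].
Qed.

Lemma ml_derive2 a x :
  0 < a -> 0 < x ->
  is_derive (fun t => a / t * PSeries (euler (ml_coeff a)) (Rpower t a)) x
    (a / x * (a / x * PSeries (euler (euler (ml_coeff a))) (Rpower x a))
     - a / x ^ 2 * PSeries (euler (ml_coeff a)) (Rpower x a)).
Proof.
  intros Ha Hx. evar_last.
  - apply (is_derive_mult (fun t => a / t)
      (fun t => PSeries (euler (ml_coeff a)) (Rpower t a))).
    + auto_derive; [lra|reflexivity].
    + apply is_derive_PSeries_Rpower; [|exact Hx].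
      rewrite CV_radius_euler. apply CV_radius_ml_coeff, Ha.
    + apply Rmult_comm.
  - unfold plus, mult; simpl. field. lra.
Qed.

Lemma ml_pos a x : 0 < a -> 0 < x -> 0 < mittag_leffler a (Rpower x a).
Proof.
  intros Ha Hx. rewrite mittag_leffler_PSeries, <- ml_term_series_0.
  rewrite Series_incr_1 by (apply ex_series_ml_term; assumption).
  assert (0 <= Series (fun k => ml_term a x (S k))).
  { rewrite <- (Rmult_0_l (Series (fun _ => 0))), <- Series_scal_l.
    apply Series_le.
    - intros k. pose proof (ml_term_pos a x (S k) Ha). lra.
    - apply (ex_series_incr_1 (V := R_NormedModule) (ml_term a x)).
      apply ex_series_ml_term; assumption. }
  pose proof (ml_term_pos a x 0 Ha). lra.
Qed.

(** Allows the comparison of f with f' to be multiplied by f', in either range of a. *)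
Lemma ml_derive_nonneg a x :
  0 < a -> 0 < x -> 0 <= a / x * PSeries (euler (ml_coeff a)) (Rpower x a).
Proof.
  intros Ha Hx. apply Rmult_le_pos; [left; apply Rdiv_lt_0_compat; lra|].
  unfold PSeries. rewrite <- (Rmult_0_l (Series (fun _ => 0))), <- Series_scal_l.
  apply Series_le.
  - intros k. split; [lra|]. rewrite Rmult_0_l. unfold euler.
    repeat apply Rmult_le_pos; [apply pos_INR|left; apply ml_coeff_pos, Ha|].
    apply pow_le; left; apply exp_pos.
  - apply ex_series_Rabs, CV_disk_inside.
    rewrite CV_radius_euler, CV_radius_ml_coeff by exact Ha. exact I.
Qed.

Theorem theorem2p2 :
  (forall alpha : R, 0 < alpha < 1 ->
     log_concave_pos (fun x => mittag_leffler alpha (Rpower x alpha))) /\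
  (forall alpha : R, 1 < alpha < 2 ->
     log_convex_pos (fun x => mittag_leffler alpha (Rpower x alpha))).
Proof.
  split; intros a Ha.
  - eapply log_concave_of_derive2; intros t Ht;
      [apply ml_pos; lra|apply ml_derive; lra|apply ml_derive2; lra|].
    assert (Hp := ml_pos a t ltac:(lra) Ht).
    assert (Hd := ml_derive_nonneg a t ltac:(lra) Ht).
    destruct (ml_signs_lt_1 a t Ha Ht) as (H1 & H2).
    rewrite <- ml_term_series_2 by lra.
    rewrite mittag_leffler_PSeries, <- ml_term_series_0 in *.
    rewrite <- ml_term_series_1 in *. nra.
  - eapply log_convex_of_derive2; intros t Ht;
      [apply ml_pos; lra|apply ml_derive; lra|apply ml_derive2; lra|].
    assert (Hp := ml_pos a t ltac:(lra) Ht).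
    assert (Hd := ml_derive_nonneg a t ltac:(lra) Ht).
    destruct (ml_signs_gt_1 a t Ha Ht) as (H1 & H2).
    rewrite <- ml_term_series_2 by lra.
    rewrite mittag_leffler_PSeries, <- ml_term_series_0 in *.
    rewrite <- ml_term_series_1 in *. nra.
Qed.
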